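(* Let $\Lambda$ be a finite-dimensional algebra over a field $K$. (a) If $\det C_\Lambda\neq0$ and the matrix $C_\Lambda^{-1}C_\Lambda^T$ has integer entries, then the Coxeter polynomial $\phi_\Lambda$ is representable by a monic polynomial. (b) If $\Lambda$ is Iwanaga-Gorenstein with $\det C_\Lambda\neq0$, then $\phi_\Lambda$ is representable by a monic polynomial. (c) In particular, Coxeter polynomials of triangular algebras, or more generally of algebras of finite global dimension, are representable by monic polynomials.
   Context: For a finite-dimensional $K$-algebra $\Lambda$, let $P_1,\dots,P_n$ be a complete collection of pairwise non-isomorphic indecomposable projective right $\Lambda$-modules. The Cartan matrix $C_\Lambda\in M_n(\mathbb{Z})$ has entries $(C_\Lambda)_{ij}=\dim_K\mathrm{Hom}_\Lambda(P_i,P_j)$. If $\det C_\Lambda\ne0$, the Coxeter polynomial is $\phi_\Lambda(x)=\det(xI_n+C_\Lambda^{-1}C_\Lambda^T)$. (If $\Lambda$ has finite global dimension, then $\det C_\Lambda\neq 0$.) $\Lambda$ is Iwanaga-Gorenstein if its $K$-dual $\Lambda^*=\mathrm{Hom}_K(\Lambda,K)$ has a finite projective resolution as a right $\Lambda$-module and $\Lambda_\Lambda$ has a finite injective resolution; in that case the perfect derived category $\mathrm{per}\,\Lambda$ has a Serre functor $\nu=-\otimes^{\mathbf{L}}_\Lambda\Lambda^*$, and $\phi_\Lambda$ is the characteristic polynomial of $-[\nu]$ on $K_0(\mathrm{per}\,\Lambda)$, which agrees with the previous definition when $\det C_\Lambda\neq0$. A triangular algebra is a quotient $KQ/I$ where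 $Q$ is a finite quiver without oriented cycles and $I$ is an ideal generated by linear combinations of parallel paths (same start and same end) of lengths at least $2$. A polynomial $\phi\in\mathbb{Z}[x]$ is represented by a polynomial $q\in\mathbb{Z}[y]$ if $\phi(x^2)=x^{\deg q}\cdot q(x+x^{-1})$; ''representable by a monic polynomial'' means represented by some monic $q\in\mathbb{Z}[y]$. *)

(* Defs.v *)
From HB Require Import structures.
From mathcomp Require Import all_boot all_order all_algebra all_field.
From mathcomp Require Import finmap.
From mathcomp.multinomials Require Import monalg.

Set Implicit Arguments.
Unset Strict Implicit.
Unset Printing Implicit Defensive.

Import GRing.Theory.
Local Open Scope ring_scope.

(* Right modules over a ring A are left modules over the converse ring A^c, so
   m.a is written (a : A^c) *: m, and right A-linear maps M -> N are
   {linear M -> N} for M N : lmodType A^c.  The first definitions make sense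
   over any ring R. *)

Section Modules.
Variable R : pzRingType.
Implicit Types M N : lmodType R.

Definition mod_iso M N : Prop := exists f : {linear M -> N}, bijective f.

Definition zero_module M : Prop := forall x : M, x = 0.

Definition projective M : Prop :=
  forall (X Y : lmodType R) (p : {linear X -> Y}) (f : {linear M -> Y}),
    (forall y, exists x, p x = y) ->
    exists g : {linear M -> X}, forall m, p (g m) = f m.

Definition injective_module M : Prop :=
  forall (X Y : lmodType R) (i : {linear X -> Y}) (f : {linear X -> M}),
    injective i ->
    exists g : {linear Y -> M}, forall x, g (i x) = f x.

Definition indecomposable M : Prop :=
  ~ zero_module M /\
  forall X Y : lmodType R,
    mod_iso M (X * Y)%type -> zero_module X \/ zero_module Y.

(* ... -> P 2 -> P 1 -> P 0 -> M -> 0 is exact, all P i are projective, and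
   P i = 0 for i > l. *)
Definition has_proj_resolution_le (l : nat) M : Prop :=
  exists (P : nat -> lmodType R) (d : forall i, {linear P i.+1 -> P i})
         (e : {linear P 0 -> M}),
  [/\ forall i, projective (P i),
      forall m, exists x, e x = m,
      forall x, e x = 0 <-> exists y, d 0 y = x,
      forall i x, d i x = 0 <-> exists y, d i.+1 y = x
    & forall i, (l < i)%N -> zero_module (P i)].

(* 0 -> M -> I 0 -> I 1 -> I 2 -> ... is exact, all I i are injective, and
   I i = 0 for i > l. *)
Definition has_inj_resolution_le (l : nat) M : Prop :=
  exists (I : nat -> lmodType R) (d : forall i, {linear I i -> I i.+1})
         (e : {linear M -> I 0}),
  [/\ forall i, injective_module (I i),
      injective e,
      forall x, d 0 x = 0 <-> exists y, e y = x,
      forall i x, d i.+1 x = 0 <-> exists y, d i y = x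
    & forall i, (l < i)%N -> zero_module (I i)].

End Modules.

Section Algebras.
Variables (K : fieldType) (A : falgType K).

(* The K-dual of A; the right action is (f.a) x = f (a x). *)
Definition Kdual : Type := 'Hom(A, K^o).
HB.instance Definition _ := GRing.Zmodule.on Kdual.

Definition Kdual_scale (a : A^c) (f : Kdual) : Kdual := (f \o amull (a : A))%VF.

Fact Kdual_scaleE a f x : Kdual_scale a f x = f ((a : A) * x).
Proof. by rewrite /Kdual_scale comp_lfunE lfunE. Qed.

Fact Kdual_scaleA a b f :
  Kdual_scale a (Kdual_scale b f) = Kdual_scale (a * b) f.
Proof. by apply/lfunP => x; rewrite !Kdual_scaleE mulrA. Qed.

Fact Kdual_scale1 : left_id 1 Kdual_scale.
Proof. by move=> f; apply/lfunP => x; rewrite Kdual_scaleE mul1r. Qed.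

Fact Kdual_scaleDr : right_distributive Kdual_scale +%R.
Proof.
move=> a f g; apply/lfunP => x.
by rewrite Kdual_scaleE !add_lfunE !Kdual_scaleE.
Qed.

Fact Kdual_scaleDl f : {morph Kdual_scale^~ f : a b / a + b}.
Proof.
move=> a b; apply/lfunP => x.
by rewrite add_lfunE !Kdual_scaleE mulrDl linearD.
Qed.

HB.instance Definition _ := GRing.Zmodule_isLmodule.Build A^c Kdual
  Kdual_scaleA Kdual_scale1 Kdual_scaleDr Kdual_scaleDl.

(* (A^c)^o is A as a right module over itself. *)
Definition iwanaga_gorenstein : Prop :=
  (exists l, has_proj_resolution_le l (Kdual : lmodType A^c)) /\
  (exists l, has_inj_resolution_le l ((A^c)^o : lmodType A^c)).

Definition finite_gldim : Prop :=
  exists l, forall M : lmodType A^c, has_proj_resolution_le l M.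

(* dim_K Hom_A(M, N) = d: there is a K-basis of d elements. *)
Definition hom_dim (M N : lmodType A^c) (d : nat) : Prop :=
  exists b : 'I_d -> {linear M -> N},
  forall f : {linear M -> N}, exists! c : {ffun 'I_d -> K},
    forall x, f x = \sum_(i < d) (((c i)%:A : A) : A^c) *: b i x.

Definition complete_indec_projectives n (P : 'I_n -> lmodType A^c) : Prop :=
  [/\ forall i, projective (P i) /\ indecomposable (P i),
      forall i j, mod_iso (P i) (P j) -> i = j
    & forall M : lmodType A^c,
        projective M -> indecomposable M -> exists i, mod_iso M (P i)].

Definition cartan_matrix n (P : 'I_n -> lmodType A^c) (C : 'M[int]_n) : Prop :=
  forall i j, exists2 d : nat, hom_dim (P i) (P j) d & C i j = d%:Z.

End Algebras.

Definition coxeter_matrix n (C : 'M[int]_n) : 'M[rat]_n :=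
  invmx (map_mx intr C) *m (map_mx intr C)^T.

Definition coxeter_poly n (C : 'M[int]_n) : {poly rat} :=
  \det ('X%:M + map_mx polyC (coxeter_matrix C)).

(* phi(x^2) = x^(deg q) q(x + x^-1), in the fraction field of Z[x]. *)
Definition represented_by (phi q : {poly int}) : Prop :=
  tofrac (phi \Po 'X^2) =
  tofrac 'X ^+ (size q).-1 * (map_poly intr q).[tofrac 'X + (tofrac 'X)^-1].

Definition representable_by_monic (p : {poly rat}) : Prop :=
  exists2 phi : {poly int}, p = map_poly intr phi &
  exists2 q : {poly int}, q \is monic & represented_by phi q.

Record quiver := Quiver {
  vertex : finType;
  arrow : finType;
  source : arrow -> vertex;
  target : arrow -> vertex }.

Section PathAlgebra.
Variables (K : fieldType) (Q : quiver).

Fixpoint walk (v : vertex Q) (s : seq (arrow Q)) : bool :=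
  if s is a :: s' then (source a == v) && walk (target a) s' else true.

(* A path is its starting vertex together with its sequence of arrows; the
   trivial paths are the (v, [::]). *)
Definition qpath : Type := {p : vertex Q * seq (arrow Q) | walk p.1 p.2}.
HB.instance Definition _ := SubChoice.on qpath.

Implicit Types p q r : qpath.

Definition pstart p : vertex Q := (val p).1.
Definition parrows p : seq (arrow Q) := (val p).2.
Definition pend p : vertex Q := last (pstart p) (map (@target Q) (parrows p)).
Definition plength p : nat := size (parrows p).
Definition ptrivial (v : vertex Q) : qpath := exist _ (v, [::]) isT.

Lemma walk_cat v s1 s2 :
  walk v (s1 ++ s2) = walk v s1 && walk (last v (map (@target Q) s1)) s2.
Proof. by elim: s1 v => //= a s1 IH v; rewrite IH andbA. Qed.

(* First p, then q; the insub always succeeds when pend p = pstart q. *)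
Definition pcomp p q : option qpath :=
  if pend p == pstart q then (insub (pstart p, parrows p ++ parrows q) : option qpath)
  else None.

Definition acyclic : Prop :=
  forall p, (0 < plength p)%N -> pend p != pstart p.

Definition path_algebra : Type := {malg K[qpath]}.
HB.instance Definition _ := GRing.Lmodule.on path_algebra.

Definition pbasis p : path_algebra := << 1 *g p >>.
Definition obasis (o : option qpath) : path_algebra := oapp pbasis 0 o.

Definition plift (f : qpath -> path_algebra) (x : path_algebra) :
    path_algebra :=
  \sum_(p <- msupp x) x@_p *: f p.

Definition pamul (x y : path_algebra) : path_algebra :=
  plift (fun p => plift (fun q => obasis (pcomp p q)) y) x.

Definition paone : path_algebra := \sum_v pbasis (ptrivial v).

Lemma pliftw f (x : path_algebra) (d : {fset qpath}) :
  (msupp x `<=` d)%fset -> plift f x = \sum_(p <- d) x@_p *: f p.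
Proof.
move=> le_xd; apply: big_fset_incl => // p _ /mcoeff_outdom ->.
by rewrite scale0r.
Qed.

Lemma plift_is_linear f : linear (plift f).
Proof.
move=> c x y; pose d := (msupp x `|` msupp y `|` msupp (c *: x + y))%fset.
have [dx dy dxy] : [/\ msupp x `<=` d, msupp y `<=` d
    & msupp (c *: x + y) `<=` d]%fset.
  by split; apply/fsubsetP => p pP; rewrite !inE pP ?orbT.
rewrite (pliftw f dx) (pliftw f dy) (pliftw f dxy) scaler_sumr -big_split /=.
by apply: eq_bigr => p _; rewrite mcoeffD mcoeffZ scalerDl scalerA.
Qed.

HB.instance Definition _ f :=
  GRing.isLinear.Build K path_algebra path_algebra *:%R (plift f)
    (plift_is_linear f).

Lemma plift_basis f p : plift f (pbasis p) = f p.
Proof. by rewrite (pliftw f msuppU_le) big_seq_fset1 mcoeffUU scale1r. Qed.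

Lemma eq_plift f g x : f =1 g -> plift f x = plift g x.
Proof. by move=> fg; apply: eq_bigr => p _; rewrite fg. Qed.

Lemma plift_id x : plift pbasis x = x.
Proof.
rewrite /plift {3}(monalgE x); apply: eq_bigr => p _.
by apply/malgP => q; rewrite mcoeffZ !mcoeffU mulr_natr.
Qed.

Lemma linear_plift (h : {linear path_algebra -> path_algebra}) f x :
  h (plift f x) = plift (h \o f) x.
Proof. by rewrite linear_sum; apply: eq_bigr => p _; rewrite linearZ. Qed.

Lemma pamul_is_linear x : linear (pamul x).
Proof.
move=> c y z; rewrite /pamul /plift scaler_sumr -big_split /=.
apply: eq_bigr => p _.
by rewrite -!/(plift _ _) linearP scalerDr !scalerA mulrC.
Qed.

HB.instance Definition _ x :=
  GRing.isLinear.Build K path_algebra path_algebra *:%R (pamul x)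
    (pamul_is_linear x).

Lemma pamulDl : left_distributive pamul +%R.
Proof. by move=> x y z; rewrite /pamul linearD. Qed.

Lemma pamulDr : right_distributive pamul +%R.
Proof. by move=> x y z; rewrite linearD. Qed.

Lemma pamul_basis p q : pamul (pbasis p) (pbasis q) = obasis (pcomp p q).
Proof. by rewrite /pamul !plift_basis. Qed.

Lemma val_pcomp p q : pend p = pstart q ->
  exists2 r, pcomp p q = Some r & val r = (pstart p, parrows p ++ parrows q).
Proof.
move=> epq; rewrite /pcomp epq eqxx; case: insubP => [r _ vr|]; first by exists r.
by rewrite /= walk_cat (valP p) /= -/(pend p) epq (valP q).
Qed.

Lemma pcompN p q : pend p != pstart q -> pcomp p q = None.
Proof. by rewrite /pcomp => /negPf ->. Qed.

Lemma pstart_pcomp p q r : pcomp p q = Some r -> pstart r = pstart p.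
Proof.
case: (eqVneq (pend p) (pstart q)) => [/val_pcomp[s -> vs] [<-]|/pcompN-> //].
by rewrite /pstart vs.
Qed.

Lemma pend_pcomp p q r : pcomp p q = Some r -> pend r = pend q.
Proof.
case: (eqVneq (pend p) (pstart q)) => [epq|/pcompN-> //].
have [s -> vs] := val_pcomp epq; case=> <-.
by rewrite /pend /pstart /parrows vs /= map_cat last_cat -/(pend p) epq.
Qed.

Lemma pcompA p q r :
  obind (pcomp p) (pcomp q r) = obind (pcomp^~ r) (pcomp p q).
Proof.
case: (eqVneq (pend q) (pstart r)) => [eqr|nqr]; last first.
  rewrite (pcompN nqr) /=; case E: (pcomp p q) => [s|] //=.
  by rewrite pcompN // (pend_pcomp E).
have [s Es vs] := val_pcomp eqr; rewrite Es /=.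
case: (eqVneq (pend p) (pstart q)) => [epq|npq]; last first.
  by rewrite (pcompN npq) pcompN // (pstart_pcomp Es).
have [t Et vt] := val_pcomp epq; rewrite Et /=.
have [u -> vu] := val_pcomp (etrans epq (esym (pstart_pcomp Es))).
have [w -> vw] := val_pcomp (etrans (pend_pcomp Et) eqr).
congr Some; apply: val_inj; rewrite vu vw (pstart_pcomp Et).
by rewrite /parrows vs vt /= catA.
Qed.

Lemma pamul_obasisl o q :
  pamul (obasis o) (pbasis q) = obasis (obind (pcomp^~ q) o).
Proof. by case: o => [p|]; [exact: pamul_basis | rewrite /pamul linear0]. Qed.

Lemma pamul_obasisr p o :
  pamul (pbasis p) (obasis o) = obasis (obind (pcomp p) o).
Proof. by case: o => [q|]; [exact: pamul_basis | rewrite linear0]. Qed.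

Lemma pamul_pliftl f x y : pamul (plift f x) y = plift (fun p => pamul (f p) y) x.
Proof. by rewrite /pamul linear_plift. Qed.

Lemma pamul_plift f x y : pamul x (plift f y) = plift (fun p => pamul x (f p)) y.
Proof. by rewrite linear_plift. Qed.

Lemma pamulA : associative pamul.
Proof.
move=> x y z; rewrite -[x]plift_id !pamul_pliftl; apply: eq_plift => p.
rewrite -[y]plift_id pamul_pliftl !pamul_plift pamul_pliftl.
apply: eq_plift => q; rewrite -[z]plift_id !pamul_plift.
apply: eq_plift => r.
by rewrite !pamul_basis pamul_obasisl pamul_obasisr pcompA.
Qed.

Lemma pamul1l : left_id paone pamul.
Proof.
move=> x; rewrite -[RHS]plift_id -[in LHS](plift_id x) pamul_plift.
apply: eq_plift => p.
rewrite /paone /pamul linear_sum (bigD1 (pstart p)) //= big1 => [|v nv].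
  rewrite addr0 -/(pamul _ _) pamul_basis.
  have [r -> vr] := @val_pcomp (ptrivial (pstart p)) p erefl.
  rewrite /=; congr (pbasis _); apply: val_inj; rewrite vr /=.
  exact/esym/surjective_pairing.
by rewrite !plift_basis pcompN.
Qed.

Lemma pamul1r : right_id paone pamul.
Proof.
move=> x; rewrite -[RHS]plift_id -[in LHS](plift_id x) pamul_pliftl.
apply: eq_plift => p.
rewrite /paone linear_sum (bigD1 (pend p)) //= big1 => [|v nv].
  rewrite addr0 pamul_basis.
  have [r -> vr] := @val_pcomp p (ptrivial (pend p)) erefl.
  rewrite /=; congr (pbasis _); apply: val_inj; rewrite vr /pstart /parrows cats0.
  exact/esym/surjective_pairing.
by rewrite pamul_basis pcompN // eq_sym.
Qed.

HB.instance Definition _ := GRing.Zmodule_isPzRing.Build path_algebra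
  pamulA pamul1l pamul1r pamulDl pamulDr.

(* A linear combination of parallel paths of length at least 2. *)
Definition relation (x : path_algebra) : Prop :=
  exists u v, forall p, p \in msupp x ->
    [/\ pstart p = u, pend p = v & (2 <= plength p)%N].

End PathAlgebra.

(* The two-sided ideal generated by S. *)
Definition ideal_gen (R : pzRingType) (S : R -> Prop) (x : R) : Prop :=
  exists m (a r b : 'I_m -> R),
    (forall i, S (r i)) /\ x = \sum_(i < m) a i * r i * b i.

(* A is isomorphic to KQ/I, i.e. there is a surjective K-algebra morphism
   KQ -> A with kernel I. *)
Definition triangular (K : fieldType) (A : falgType K) : Prop :=
  exists (Q : quiver) (S : path_algebra K Q -> Prop)
         (pi : {linear path_algebra K Q -> A}),
  [/\ acyclic Q,
      forall x, S x -> relation x,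
      monoid_morphism pi,
      forall a, exists x, pi x = a
    & forall x, pi x = 0 <-> ideal_gen S x].

(* Main.v *)
Require Import Defs.
From HB Require Import structures.
From mathcomp Require Import all_boot all_order all_algebra all_field.
From mathcomp Require Import boolp.
From mathcomp Require Import finmap.
From mathcomp.multinomials Require Import monalg.

(** The identity [det C * phi(x) = det (x C + C^T)] and transposition show that the
    Coxeter polynomial [phi] is palindromic, and a monic palindromic polynomial with
    integer coefficients is represented by a monic integer polynomial
    ([palindromic_represented]). Hence it is enough that [det C] is nonzero and that
    [C^-1 C^T] is integral, that is, [C^T = C N] for an integer matrix [N].

    Attach to a finite-dimensional module [M] its dimension vector, with entries
    [dim Hom(P_i, M)]. Column [j] of [C] is the dimension vector of [P_j], and row
    [i] is the dimension vector of the injective module [D(A e_i)], where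
    [P_i = e_i A] ([fix_dim_dual_summand]). So [C^T = C N] means that the dimension
    vectors of these injectives lie in the lattice spanned by the columns of [C].
    Dimension vectors are additive on short exact sequences, and a
    finite-dimensional projective module is a direct sum of copies of the [P_j];
    therefore the dimension vector of every finite-dimensional module of finite
    projective dimension lies in the lattice ([all_pd_in_cartan_lattice]). As the
    modules of a given resolution may be infinite-dimensional, Schanuel's lemma
    ([pd_le_all]) is needed to replace them by free modules of finite rank. For an
    Iwanaga-Gorenstein algebra this applies to the direct summands [D(A e_i)] of
    the dual of [A].

    If all dimension vectors lie in the lattice, then so do those of the simple
    modules, which are positive multiples of the unit vectors, whence [det C] is
    nonzero ([cartan_det_neq0]). This covers finite global dimension. It also covers
    triangular algebras, where a descending induction over the vertices of the
    quiver puts all dimension vectors into the lattice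
    ([directed_in_cartan_lattice]).

    That [P_i] is [e_i A] for an idempotent [e_i], so that [Hom(P_i, M)] becomes
    [M e_i], rests on Fitting's lemma in the endomorphism algebra of [P_i]
    ([exists_coord]). *)

Set Implicit Arguments.
Unset Strict Implicit.
Unset Printing Implicit Defensive.

Import GRing.Theory Num.Theory.
Local Open Scope ring_scope.

(** * Palindromic polynomials *)

Lemma coef_1addX_exp (R : comNzRingType) n i :
  (('X + 1 : {poly R}) ^+ n)`_i = 'C(n, i)%:R.
Proof.
rewrite exprD1n coef_sum.
under eq_bigr do rewrite coefMn coefXn.
have [lt_in|le_ni] := ltnP i n.+1; last first.
  rewrite bin_small // big1 // => j _.
  by rewrite gtn_eqF ?mul0rn // (leq_trans _ le_ni).
rewrite (bigD1 (Ordinal lt_in)) //= eqxx big1 ?addr0 // => j.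
by rewrite -val_eqE /= eq_sym => /negPf ->; rewrite mul0rn.
Qed.

(** Subtracting [p`_n (1 + X)^n], which is represented by [p`_n X^n], kills both
    extreme coefficients of [p]; what remains is [X] times a palindromic
    polynomial of formal degree [n - 2], and the factor [X] matches the change of
    normalisation from [X^(n-2)] to [X^n]. *)
Lemma palindromic_represented n (p : {poly int}) :
    (size p <= n.+1)%N -> (forall i, (i <= n)%N -> p`_i = p`_(n - i)) ->
  exists q : {poly int}, [/\ (size q <= n.+1)%N, q`_n = p`_n
    & tofrac (p \Po 'X^2) =
      tofrac 'X ^+ n * (map_poly intr q).[tofrac 'X + (tofrac 'X)^-1]].
Proof.
elim/ltn_ind: n p => n IHn p le_pn pal_p.
set x : {fraction {poly int}} := tofrac 'X.
have x_neq0 : x != 0 by rewrite tofrac_eq0 polyX_eq0.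
pose a := p`_n; pose r := p - a *: ('X + 1) ^+ n.
have pE : p = r + a *: ('X + 1) ^+ n by rewrite subrK.
have powE : tofrac ((a *: ('X + 1) ^+ n) \Po 'X^2) =
    x ^+ n * (map_poly intr (a *: 'X^n)).[x + x^-1].
  rewrite map_polyZ map_polyXn hornerZ hornerXn mulrCA -exprMn mulrDr divff //.
  rewrite -mul_polyC rmorphM rmorphXn rmorphD rmorph1 /= comp_polyC comp_polyX.
  rewrite rmorphM /= rmorphXn rmorphD rmorph1 rmorphXn /= -expr2.
  by congr (_ * _); rewrite -[a]intz !rmorph_int.
have r_coef i : (n < i)%N -> r`_i = 0.
  move=> lt_ni; rewrite coefB coefZ coef_1addX_exp bin_small // mulr0 subr0.
  by rewrite nth_default // (leq_trans le_pn).
have r_pal i : (i <= n)%N -> r`_i = r`_(n - i).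
  by move=> le_in; rewrite !coefB !coefZ !coef_1addX_exp bin_sub // pal_p.
have rn0 : r`_n = 0 by rewrite coefB coefZ coef_1addX_exp binn mulr1 subrr.
have r00 : r`_0 = 0 by rewrite r_pal // subn0.
have [le_n1|lt_1n] := leqP n 1.
  have r0 : r = 0.
    apply/polyP => i; rewrite coef0; have [/r_coef //|le_in] := ltnP n i.
    case: i le_in => [//|[|i]] le_in; last by have := leq_trans le_in le_n1.
    by have /eqP <- : n == 1%N by rewrite eqn_leq le_n1.
  exists (a *: 'X^n); split.
  - by rewrite (leq_trans (size_scale_leq _ _)) // size_polyXn.
  - by rewrite coefZ coefXn eqxx mulr1.
  - by rewrite {1}pE r0 add0r powE.
case: n lt_1n IHn le_pn pal_p @a @r pE powE r_coef r_pal rn0 r00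
  => [|[|m]] // _ IHn _ _ a r pE powE r_coef r_pal rn0 r00.
pose s := \poly_(i < m.+1) r`_i.+1.
have rE : r = s * 'X.
  apply/polyP => -[|i]; rewrite coefMX //= coef_poly.
  case: ltnP => // ; rewrite leq_eqVlt => /orP[/eqP <- //|lt_mi].
  exact: r_coef.
have [|||q [le_q _ qE]] := IHn m _ s.
- exact: leqnSn.
- exact: size_poly.
- move=> i le_im; rewrite !coef_poly !ltnS le_im leq_subr r_pal; last first.
    by rewrite ltnS (leq_trans le_im).
  by rewrite subSS subSn.
exists (q + a *: 'X^(m.+2)); split.
- rewrite (leq_trans (size_polyD _ _)) // geq_max (leq_trans le_q) //.
    by rewrite (leq_trans (size_scale_leq _ _)) // size_polyXn.
  by rewrite !ltnS leqW.
- by rewrite coefD coefZ coefXn eqxx mulr1 nth_default ?add0r // (leq_trans le_q).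
rewrite {1}pE comp_polyD rmorphD /= powE rE rmorphM /= comp_polyX rmorphM /= qE.
rewrite rmorphD /= hornerD mulrDr; congr (_ + _).
by rewrite rmorphXn /= -/x mulrAC -exprD addn2.
Qed.

(** The polynomial with the reversed coefficients takes the same values as [p] at
    the infinitely many nonzero points of [F]. *)
Lemma coef_palindromic (F : numFieldType) n (p : {poly F}) :
    (size p <= n.+1)%N -> (forall x, x != 0 -> x ^+ n * p.[x^-1] = p.[x]) ->
  forall i, (i <= n)%N -> p`_i = p`_(n - i).
Proof.
move=> le_pn pE i le_in.
pose q := \poly_(j < n.+1) p`_(n - j).
suff /polyP/(_ (n - i)%N) : q = p.
  by rewrite coef_poly ltnS leq_subr subKn.
have qE x : x != 0 -> q.[x] = p.[x].
  move=> x_neq0; rewrite -pE // horner_poly (horner_coef_wide _ le_pn) mulr_sumr.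
  rewrite [RHS](reindex_inj rev_ord_inj) /=; apply: eq_bigr => j _.
  rewrite subSS exprVn mulrCA; congr (_ * _).
  have le_jn : (j <= n)%N by rewrite -ltnS.
  by rewrite -{2}(subnKC le_jn) exprD mulfK // expf_neq0.
apply/eqP; rewrite -subr_eq0; apply/eqP.
pose s := [seq k.+1%:R | k <- iota 0 (size (q - p))] : seq F.
apply: (@roots_geq_poly_eq0 _ _ s).
- apply/allP => _ /mapP[k _ ->]; rewrite rootE hornerD hornerN subr_eq0.
  by rewrite qE // pnatr_eq0.
- rewrite map_inj_uniq ?iota_uniq // => j k /eqP.
  by rewrite eqr_nat eqSS => /eqP.
- by rewrite size_map size_iota.
Qed.

Section Coxeter.
Variables (n : nat) (C : 'M[int]_n).

Let D : 'M[rat]_n := map_mx intr C.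

Lemma horner_coxeter_poly x :
  (coxeter_poly C).[x] = \det (x%:M + coxeter_matrix C).
Proof.
rewrite -[LHS]/(horner_eval x _) -det_map_mx; congr (\det _).
apply/matrixP => i j; rewrite !mxE /= /horner_eval hornerD hornerMn hornerX.
by rewrite hornerC.
Qed.

(** As [det C * phi(x) = det (x C + C^T)], transposing the matrix exchanges
    [x] and [x^-1] up to the factor [x^n]. *)
Lemma coxeter_poly_reciprocal x : \det C != 0 -> x != 0 ->
  x ^+ n * (coxeter_poly C).[x^-1] = (coxeter_poly C).[x].
Proof.
move=> detC x_neq0.
have uD : D \in unitmx by rewrite unitmxE unitfE det_map_mx intr_eq0.
have detE y : \det D * (coxeter_poly C).[y] = \det (y *: D + D^T).
  rewrite horner_coxeter_poly -det_mulmx mulmxDr mul_mx_scalar.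
  by rewrite /coxeter_matrix mulKVmx.
apply: (mulfI (_ : \det D != 0)); first by rewrite -unitfE -unitmxE.
rewrite mulrCA !detE -detZ scalerDr scalerA divff // scale1r -det_tr.
by rewrite linearD /= linearZ /= trmxK addrC.
Qed.

Lemma coxeter_representable (N : 'M[int]_n) :
  \det C != 0 -> coxeter_matrix C = map_mx intr N ->
  representable_by_monic (coxeter_poly C).
Proof.
move=> detC NE; pose phi := char_poly (- N).
have phiE : coxeter_poly C = map_poly intr phi.
  rewrite /coxeter_poly NE /phi /char_poly -det_map_mx; congr (\det _).
  apply/matrixP => i j; rewrite !mxE rmorphB rmorphMn /= map_polyX.
  by rewrite map_polyC /= rmorphN /= polyCN opprK.
have size_phi : size phi = n.+1 by rewrite size_char_poly.
have phi_pal i : (i <= n)%N -> phi`_i = phi`_(n - i).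
  move=> le_in; apply: (@intr_inj rat); rewrite -!coef_map -phiE.
  apply: coef_palindromic => // [|x x_neq0].
    by rewrite phiE size_map_inj_poly ?size_phi //; exact: intr_inj.
  exact: coxeter_poly_reciprocal.
have [|q [le_q qn qE]] := @palindromic_represented n phi _ phi_pal.
  by rewrite size_phi.
have qn1 : q`_n = 1.
  by rewrite qn; have := char_poly_monic (- N); rewrite monicE lead_coefE size_phi => /eqP.
have size_q : size q = n.+1.
  apply/eqP; rewrite eqn_leq le_q ltnNge; apply: contra_eqN qn1 => le_qn.
  by rewrite nth_default // eq_sym oner_eq0.
exists phi => //; exists q; last by rewrite /represented_by size_q.
by rewrite monicE lead_coefE size_q qn1.
Qed.

End Coxeter.

Lemma coxeter_representable_of_int n (C : 'M[int]_n) :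
  \det C != 0 -> (forall i j, coxeter_matrix C i j \is a Num.int) ->
  representable_by_monic (coxeter_poly C).
Proof.
move=> detC Cint.
apply: (@coxeter_representable _ C (\matrix_(i, j) Num.floor (coxeter_matrix C i j))) => //.
by apply/matrixP => i j; rewrite [RHS]mxE [X in X%:~R]mxE floorK.
Qed.

Lemma coxeter_representable_of_mul n (C N : 'M[int]_n) :
  \det C != 0 -> C^T = C *m N -> representable_by_monic (coxeter_poly C).
Proof.
move=> detC CE; apply: (@coxeter_representable _ C N) => //.
rewrite /coxeter_matrix map_trmx CE map_mxM mulKmx //.
by rewrite unitmxE unitfE det_map_mx intr_eq0.
Qed.

(** * Submodules, kernels and short exact sequences *)

Section Submodules.
Variables (R : nzRingType) (M : lmodType R) (S : submodClosed M).

Record submod := Submod { submod_val : M; _ : submod_val \in S }.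
HB.instance Definition _ := [isSub for submod_val].
HB.instance Definition _ := [Choice of submod by <:].
HB.instance Definition _ := [SubChoice_isSubLmodule of submod by <:].

Lemma submod_valP (x : M) : x \in S -> exists z : submod, val z = x.
Proof. by move=> xS; exists (Submod xS). Qed.

End Submodules.

Section Kernel.
Variables (R : nzRingType) (M N : lmodType R) (f : {linear M -> N}).

Definition ker_pred : {pred M} := [pred x | f x == 0].

Fact ker_submod_closed : submod_closed ker_pred.
Proof.
split=> [|a x y]; rewrite !inE ?linear0 //.
by move=> /eqP fx /eqP fy; rewrite linearP fx fy scaler0 addr0.
Qed.
HB.instance Definition _ :=
  GRing.isSubmodClosed.Build R M ker_pred ker_submod_closed.

Definition ker : lmodType R := submod ker_pred.

(** Locked, so that simplification preserves the form in which [ker_inclK] and the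
    factorisation lemmas rewrite it. *)
Definition ker_incl : {linear ker -> M} := locked (val : {linear ker -> M}).

Lemma ker_incl_inj : injective ker_incl.
Proof. by rewrite /ker_incl; unlock; exact: val_inj. Qed.

Lemma ker_inclK z : f (ker_incl z) = 0.
Proof. by rewrite /ker_incl; unlock; apply/eqP/(valP z). Qed.

Lemma ker_inclP x : f x = 0 <-> exists z, ker_incl z = x.
Proof.
split=> [fx|[z <-]]; last exact: ker_inclK.
have [|z zE] := @submod_valP R M ker_pred x; first by rewrite inE fx.
by exists z; rewrite -zE /ker_incl; unlock.
Qed.

End Kernel.

Section Modules.
Variable R : nzRingType.
Implicit Types M N X Y Z W : lmodType R.

Lemma exists_linear M N (f : M -> N) :
  linear f -> exists g : {linear M -> N}, g =1 f.
Proof.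
move=> lin_f.
pose g : {linear M -> N} :=
  HB.pack_for {linear M -> N} f (GRing.isLinear.Build R M N *:%R f lin_f).
by exists g.
Qed.

Lemma exists_linear_factor Z X W (i : {linear Z -> X}) (f : {linear W -> X}) :
    injective i -> (forall w, exists z, i z = f w) ->
  exists g : {linear W -> Z}, forall w, i (g w) = f w.
Proof.
move=> inj_i ex_z.
have ex_zb w : exists z, i z == f w by have [z <-] := ex_z w; exists z.
pose g w := xchoose (ex_zb w).
have gE w : i (g w) = f w by apply/eqP; exact: (xchooseP (ex_zb w)).
have [|h hE] := @exists_linear W Z g; last by exists h => w; rewrite hE.
by move=> a x y; apply: inj_i; rewrite linearP !gE linearP.
Qed.

Definition short_exact Z X M (i : {linear Z -> X}) (q : {linear X -> M}) :=
  [/\ injective i, forall m, exists x, q x = m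
    & forall x, q x = 0 <-> exists z, i z = x].

Lemma ker_short_exact X M (q : {linear X -> M}) :
  (forall m, exists x, q x = m) -> short_exact (ker_incl q) q.
Proof. by split=> // [|x]; [exact: ker_incl_inj | exact: ker_inclP]. Qed.

Lemma short_exactK Z X M (i : {linear Z -> X}) (q : {linear X -> M}) z :
  short_exact i q -> q (i z) = 0.
Proof. by case=> _ _ ker_q; apply/ker_q; exists z. Qed.

Definition pairl X Y (x : X) : (X * Y)%type := (x, 0).
Definition pairr X Y (y : Y) : (X * Y)%type := (0, y).

Fact pairl_linear X Y : linear (@pairl X Y).
Proof. by move=> a x y; congr pair; rewrite /= scaler0 addr0. Qed.
HB.instance Definition _ X Y :=
  GRing.isLinear.Build R X (X * Y)%type *:%R (@pairl X Y) (@pairl_linear X Y).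

Fact pairr_linear X Y : linear (@pairr X Y).
Proof. by move=> a x y; congr pair; rewrite /= scaler0 addr0. Qed.
HB.instance Definition _ X Y :=
  GRing.isLinear.Build R Y (X * Y)%type *:%R (@pairr X Y) (@pairr_linear X Y).

Lemma pairlrE X Y (w : (X * Y)%type) : w = pairl Y w.1 + pairr X w.2.
Proof. by case: w => x y; congr pair; rewrite ?addr0 ?add0r. Qed.

Lemma short_exact_pair X Y : short_exact (@pairl X Y) (@snd X Y).
Proof.
split=> [x y [] //|y|[x y]] /=; first by exists (0, y).
by split=> [->|[z [_ <-]] //]; exists x.
Qed.

(** * Projective modules and retracts *)

(** The universal property of the free module on the underlying set of [M]. *)
Lemma exists_linear_malg M X (b : M -> X) : exists g : {linear {malg R[M]} -> X},
  forall y, g y = \sum_(k <- msupp y) y@_k *: b k.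
Proof.
apply: exists_linear => a y z.
pose d := (msupp y `|` msupp z `|` msupp (a *: y + z))%fset.
have sumE (t : {malg R[M]}) : (msupp t `<=` d)%fset ->
    \sum_(k <- msupp t) t@_k *: b k = \sum_(k <- d) t@_k *: b k.
  move=> le_td; apply: big_fset_incl => // k _ /mcoeff_outdom ->.
  by rewrite scale0r.
have [dy dz dyz] : [/\ msupp y `<=` d, msupp z `<=` d
    & msupp (a *: y + z) `<=` d]%fset.
  by split; apply/fsubsetP => k kP; rewrite !inE kP ?orbT.
rewrite !sumE // scaler_sumr -big_split /=.
by apply: eq_bigr => k _; rewrite mcoeffD mcoeffZ scalerDl scalerA.
Qed.

Lemma exists_free_cover M : exists2 q : {linear {malg R[M]} -> M},
  forall x, q x = \sum_(k <- msupp x) x@_k *: k & forall m, exists x, q x = m.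
Proof.
have [q qE] := exists_linear_malg (@idfun M); exists q => // m.
exists << m >>; rewrite qE (big_fset_incl _ msuppU_le) ?big_seq_fset1.
  by rewrite mcoeffUU scale1r.
by move=> k _ /mcoeff_outdom ->; rewrite scale0r.
Qed.

Lemma projective_retract M N (s : {linear N -> M}) (r : {linear M -> N}) :
  cancel s r -> projective M -> projective N.
Proof.
move=> sK projM X Y p f p_surj.
have [g gE] := projM X Y p (f \o r)%FUN p_surj.
by exists (g \o s)%FUN => n; rewrite /= gE /= sK.
Qed.

Lemma projective_pair M N :
  projective M -> projective N -> projective (M * N)%type.
Proof.
move=> projM projN X Y p f p_surj.
have [g gE] := projM X Y p (f \o @pairl M N)%FUN p_surj.
have [h hE] := projN X Y p (f \o @pairr M N)%FUN p_surj.
have [|k kE] := @exists_linear (M * N)%type X (fun x => g x.1 + h x.2).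
  by move=> a x y; rewrite /= !linearP scalerDr addrACA.
exists k => w; rewrite kE linearD gE hE [w in RHS]pairlrE linearD.
by [].
Qed.

Lemma projective_ffun (I : finType) : projective {ffun I -> R^o}.
Proof.
move=> X Y p f p_surj.
pose delta i : {ffun I -> R^o} := [ffun j => (i == j)%:R].
have /(_ _)/cid-/all_sig[x xE] : forall i, exists x, p x = f (delta i).
  by move=> i; exact: p_surj.
have [|g gE] := @exists_linear {ffun I -> R^o} X (fun y => \sum_i y i *: x i).
  move=> a y z; rewrite scaler_sumr -big_split; apply: eq_bigr => i _.
  by rewrite !ffunE scalerDl scalerA.
exists g => y; rewrite gE linear_sum.
rewrite (eq_bigr (fun i => f (y i *: delta i))); last first.
  by move=> i _; rewrite !linearZ xE.
rewrite -linear_sum; congr (f _); apply/ffunP => j.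
rewrite sum_ffunE (bigD1 j) //= !ffunE eqxx [_ *: _]mulr1 big1 ?addr0 // => i ne_ij.
by rewrite !ffunE (negPf ne_ij) scaler0.
Qed.

Lemma projective_malg M : projective {malg R[M]}.
Proof.
move=> X Y p f p_surj.
have /(_ _)/cid-/all_sig[x xE] : forall k : M, exists x, p x = f << k >>.
  by move=> k; exact: p_surj.
have [g gE] := exists_linear_malg x.
exists g => y; rewrite gE [in RHS](monalgE y) !linear_sum; apply: eq_bigr => k _.
rewrite linearZ xE -linearZ; congr (f _).
by apply/malgP => l; rewrite mcoeffZ !mcoeffU mulr_natr.
Qed.
End Modules.

(** * Projective dimension *)

Section ProjectiveDimension.
Variable R : nzRingType.
Implicit Types M N X Y Z W : lmodType R.

(** A projective resolution of length [l], unfolded along its syzygies; it exists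
    exactly when [M] has projective dimension at most [l]. *)
Fixpoint pd_le (l : nat) M : Prop :=
  if l is l'.+1 then
    exists Z X (i : {linear Z -> X}) (q : {linear X -> M}),
      [/\ projective X, short_exact i q & pd_le l' Z]
  else projective M.

(** The variant of [pd_le] that quantifies over all choices of presentations. It
    follows from [pd_le] by Schanuel's lemma, and it is the form that passes to
    direct summands and to finitely generated free covers. *)
Fixpoint all_pd_le (l : nat) M : Prop :=
  if l is l'.+1 then
    forall Z X (i : {linear Z -> X}) (q : {linear X -> M}),
      projective X -> short_exact i q -> all_pd_le l' Z
  else projective M.

Lemma has_proj_resolution_pd_le l M : has_proj_resolution_le l M -> pd_le l M.
Proof.
elim: l M => [|l IHl] M [P [d [e [projP e_surj ker_e ker_d P0]]]].
  have inj_e : injective e.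
    apply: raddf_inj => x /ker_e[y <-]; rewrite (P0 1%N _ y) //.
    exact: linear0.
  have [|s sK] := @exists_linear_factor R _ _ M e idfun inj_e.
    by move=> m; have [x <-] := e_surj m; exists x.
  exact: (@projective_retract R _ _ s e).
exists (ker e), (P 0), (ker_incl e), e; split=> //.
  exact: ker_short_exact.
apply: IHl.
have [|e' e'E] := @exists_linear_factor R _ _ _ (ker_incl e) (d 0%N) (@ker_incl_inj _ _ _ e).
  by move=> y; apply/ker_inclP/ker_e; exists y.
exists (fun i => P i.+1), (fun i => d i.+1), e'; split=> //.
- move=> z; have /ker_e[y yE] := ker_inclK z.
  by exists y; apply: (@ker_incl_inj _ _ _ e); rewrite e'E.
- move=> x; split.
    by move=> e'x; apply/ker_d; rewrite -e'E e'x linear0.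
  by move=> /ker_d dx; apply: (@ker_incl_inj _ _ _ e); rewrite e'E dx linear0.
- by move=> i lt_li; apply: P0.
Qed.

Lemma pd_le_pair l M Y : pd_le l M -> projective Y -> pd_le l (M * Y)%type.
Proof.
case: l => [|l] /=; first exact: projective_pair.
move=> [Z [X [i [q [projX [inj_i q_surj ker_q] pdZ]]]]] projY.
have [|j jE] := @exists_linear R Z (X * Y)%type (fun z => (i z, 0)).
  by move=> a x y; rewrite linearP; congr pair; rewrite /= scaler0 addr0.
have [|p pE] := @exists_linear R (X * Y)%type (M * Y)%type (fun x => (q x.1, x.2)).
  by move=> a x y; rewrite /= linearP.
exists Z, (X * Y)%type, j, p; split=> //; first exact: projective_pair.
split=> [z z'|[m y]|[x y]].
- by rewrite !jE => -[/inj_i].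
- by have [x <-] := q_surj m; exists (x, y); rewrite pE.
- rewrite pE /=; split=> [[qx ->]|[z]].
    by have /ker_q[z <-] := qx; exists z; rewrite jE.
  by rewrite jE => -[<- <-]; congr pair; apply/ker_q; exists z.
Qed.

(** A presentation [Z -> X -> N] of the summand and one of the complementary
    summand of [M] add up to a presentation of [M], in whose kernel [Z] is a direct
    summand. *)
Lemma all_pd_le_retract l M N (s : {linear N -> M}) (r : {linear M -> N}) :
  cancel s r -> all_pd_le l M -> all_pd_le l N.
Proof.
elim: l M N s r => [|l IHl] M N s r sK /=; first exact: projective_retract.
move=> pdM Z X i q projX [inj_i q_surj ker_q].
have [q' _ q'_surj] := exists_free_cover M.
pose Y := {malg R[M]}.
(* On [Y] the free cover of [M] is corrected by the projection of [M] onto the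
   complement of [N]. *)
have [|p pE] := @exists_linear R (X * Y)%type M
    (fun x => s (q x.1) + (q' x.2 - s (r (q' x.2)))).
  move=> a x y; rewrite /= !linearP /= scalerDr scalerDr scalerN.
  by rewrite ?opprD [RHS]addrACA; congr (_ + _); rewrite addrACA.
have rp w : r (p w) = q w.1.
  by rewrite pE /= linearD linearB !sK subrr addr0.
have p_surj m : exists x, p x = m.
  have [x xE] := q_surj (r m); have [y yE] := q'_surj m.
  by exists (x, y); rewrite pE /= xE yE addrC subrK.
have pdk : all_pd_le l (ker p).
  apply: (pdM _ _ (ker_incl p) p); last exact: ker_short_exact.
  exact/projective_pair/projective_malg.
have [|t tE] := @exists_linear R Z (X * Y)%type (fun z => (i z, 0)).
  by move=> a x y; rewrite linearP; congr pair; rewrite /= scaler0 addr0.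
have [|u uE] := @exists_linear_factor R _ _ _ (ker_incl p) t (@ker_incl_inj _ _ _ p).
  move=> z; apply/ker_inclP; rewrite tE pE /= !(linear0, addr0).
  by rewrite (proj2 (ker_q _)) ?linear0 //; exists z.
have [|v vE] := @exists_linear_factor R _ _ _ i (fst \o ker_incl p)%FUN inj_i.
  move=> w; apply/ker_q.
  by rewrite -[LHS]/(q (ker_incl p w).1) -rp ker_inclK linear0.
apply: (IHl _ _ u v) pdk => z.
by apply: inj_i; rewrite vE -[LHS]/(ker_incl p (u z)).1 uE tE.
Qed.

(** Schanuel's lemma. For presentations [Z -> X -> M] and [Z' -> Y -> M], lifting
    the projectives [X] and [Y] over each other makes [Z'] a direct summand of
    [Z * Y], whose projective dimension is bounded like that of [Z]. *)
Lemma pd_le_all l M : pd_le l M -> all_pd_le l M.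
Proof.
elim: l M => [//|l IHl] M [Z [X [i [q [projX exq pdZ]]]]] Z' Y i' q' projY exq'.
have [inj_i q_surj ker_q] := exq; have [inj_i' q'_surj ker_q'] := exq'.
have pdZY : all_pd_le l (Z * Y)%type by exact/IHl/pd_le_pair.
have [f fE] := projY _ _ q q' q_surj.
have [g gE] := projX _ _ q' q q'_surj.
have [|s1 s1E] := @exists_linear_factor R Z X Z' i (f \o i')%FUN inj_i.
  by move=> z /=; apply/ker_q; rewrite fE (short_exactK _ exq').
have [|s sE] := @exists_linear R Z' (Z * Y)%type (fun z => (s1 z, i' z)).
  by move=> a x y; rewrite !linearP.
have [|r0 r0E] := @exists_linear R (Z * Y)%type Y
    (fun w => g (i w.1) + (w.2 - g (f w.2))).
  move=> a x y; rewrite /= !linearP /= scalerDr scalerDr scalerN.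
  by rewrite ?opprD [RHS]addrACA; congr (_ + _); rewrite addrACA.
have [|r rE] := @exists_linear_factor R Z' Y _ i' r0 inj_i'.
  move=> [z y]; apply/ker_q'; rewrite r0E /= linearD linearB !gE fE subrr addr0.
  exact: short_exactK exq.
apply: (all_pd_le_retract (s := s) (r := r)) pdZY => z; apply: inj_i'.
by rewrite rE r0E sE /= s1E addrC subrK.
Qed.

End ProjectiveDimension.

Lemma linear_inverse (R : nzRingType) (M N : lmodType R) (f : {linear M -> N}) :
  bijective f -> exists g : {linear N -> M}, cancel f g /\ cancel g f.
Proof.
case=> g0 fK gK; have [|g gE] := @exists_linear R N M g0.
  by move=> a x y; apply: (can_inj fK); rewrite linearP !gK.
by exists g; split=> x; rewrite gE ?fK ?gK.
Qed.

Lemma short_exact_bij_l (R : nzRingType) (W Z X M : lmodType R)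
    (h : {linear W -> X}) (i : {linear Z -> X}) (q : {linear X -> M}) :
  bijective h -> short_exact i q -> exists j : {linear Z -> W}, short_exact j (q \o h)%FUN.
Proof.
move=> bij_h [inj_i q_surj ker_q]; have [g [hK gK]] := linear_inverse bij_h.
exists (g \o i)%FUN; split=> [|m|x] /=.
- by apply: inj_comp => //; exact: can_inj gK.
- by have [x <-] := q_surj m; exists (g x); rewrite /= gK.
- split=> [/ker_q[z zE]|[z <-]]; first by exists z; rewrite /= zE hK.
  by rewrite /= gK; apply/ker_q; exists z.
Qed.

(** * Dimension of abstract vector spaces *)

Section Dimension.
Variable K : fieldType.
Implicit Types V W X Z : lmodType K.

Definition has_dim V (d : nat) : Prop :=
  exists f : {linear V -> 'rV[K]_d}, bijective f.

Definition fin_dim V : Prop := exists d, has_dim V d.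

Definition dimK V : nat :=
  if pselect (fin_dim V) is left fdV then sval (cid fdV) else 0%N.

Lemma dimKP V : fin_dim V -> has_dim V (dimK V).
Proof. by rewrite /dimK; case: pselect => // fdV _; exact: (svalP (cid fdV)). Qed.

Lemma has_dim_vspace W (vT : vectType K) (U : {vspace vT}) (f : {linear W -> vT}) :
    injective f -> (forall u, u \in U <-> exists w, f w = u) ->
  has_dim W (\dim U).
Proof.
move=> inj_f fU.
have fM w : f w \in U by apply/fU; exists w.
have [|g gE] := @exists_linear K W 'rV_(\dim U)
    (fun w => \row_i coord (vbasis U) i (f w)).
  by move=> a x y; apply/rowP => i; rewrite !mxE !linearP.
have /(_ _)/cid-/all_sig[h hE] (r : 'rV[K]_(\dim U)) :
    exists w, f w = \sum_i r 0 i *: (vbasis U)`_i.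
  apply/fU; apply: rpred_sum => i _; apply: rpredZ.
  by apply: vbasis_mem; apply: mem_nth; rewrite size_tuple.
exists g, h => [w|r].
  apply: inj_f; rewrite hE [RHS](coord_vbasis (fM w)).
  by apply: eq_bigr => i _; rewrite gE mxE.
rewrite gE; apply/rowP => i; rewrite mxE hE coord_sum_free //.
exact: basis_free (vbasisP U).
Qed.

Lemma has_dim_vect (vT : vectType K) : has_dim vT (\dim {:vT}).
Proof.
apply: (@has_dim_vspace _ _ _ idfun) => // u.
by split=> [_|_]; [exists u | exact: memvf].
Qed.

Lemma dim_rV d : \dim {:'rV[K]_d} = d.
Proof. by rewrite dimvf /dim /= mul1n. Qed.

Lemma has_dim_uniq V d d' : has_dim V d -> has_dim V d' -> d = d'.
Proof.
move=> [f /linear_inverse[f' [fK f'K]]] [g /linear_inverse[g' [gK g'K]]].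
suff le a b (h : {linear 'rV[K]_a -> 'rV[K]_b}) : injective h -> (a <= b)%N.
  apply/eqP; rewrite eqn_leq; apply/andP; split.
    apply: (le _ _ (g \o f')%FUN).
    by apply: inj_comp; [exact: can_inj gK | exact: can_inj f'K].
  apply: (le _ _ (f \o g')%FUN).
  by apply: inj_comp; [exact: can_inj fK | exact: can_inj g'K].
move=> inj_h; have := limg_ker_dim (linfun h) fullv.
have /eqP-> : lker (linfun h) == 0%VS.
  by apply/lker0P => x y; rewrite !lfunE => /inj_h.
rewrite capv0 dimv0 add0n dim_rV => <-.
by rewrite (leq_trans (dimvS (subvf _))) // dim_rV.
Qed.

Lemma dimKE V d : has_dim V d -> dimK V = d.
Proof. by move=> dV; apply: has_dim_uniq (dV); apply: dimKP; exists d. Qed.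

Lemma fin_dim_vect (vT : vectType K) : fin_dim vT.
Proof. by exists (\dim {:vT}); exact: has_dim_vect. Qed.

Lemma has_dim_bij V W (f : {linear V -> W}) d :
  bijective f -> has_dim W d -> has_dim V d.
Proof.
move=> bij_f [g bij_g]; exists (g \o f)%FUN; exact: bij_comp.
Qed.

Lemma dimK_bij V W (f : {linear V -> W}) :
  bijective f -> fin_dim W -> dimK V = dimK W.
Proof. by move=> bij_f /dimKP dW; apply: dimKE; exact: has_dim_bij bij_f dW. Qed.

(** A subspace of maximal dimension among those contained in the image of [f] is
    the whole image: a vector outside it would span a larger one with it. *)
Lemma exists_vspace_image W (vT : vectType K) (f : {linear W -> vT}) :
  exists U : {vspace vT}, forall u, u \in U <-> exists w, f w = u.
Proof.
pose inside (U : {vspace vT}) := forall u, u \in U -> exists w, f w = u.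
pose P k := `[< exists2 U, inside U & \dim U = k >].
have exP : exists k, P k.
  exists 0%N; apply/asboolP; exists 0%VS; last exact: dimv0.
  by move=> u; rewrite memv0 => /eqP ->; exists 0; rewrite linear0.
have leP k : P k -> (k <= \dim {:vT})%N.
  by move=> /asboolP[U _ <-]; rewrite dimvS ?subvf.
have [k /asboolP[U UP dU] maxk] := ex_maxnP exP leP.
exists U => u; split=> [/UP //|[w wE]]; apply: contrapT => /negP uNU.
have : P (\dim (U + <[u]>)%VS).
  apply/asboolP; exists (U + <[u]>)%VS => // v /memv_addP[u1 u1U [_ /vlineP[c ->] ->]].
  have [w1 w1E] := UP _ u1U.
  by exists (w1 + c *: w); rewrite linearD linearZ wE w1E.
move/maxk; rewrite leqNgt -dU => /negP; apply.
rewrite ltn_neqAle dimvS ?addvSl // andbT; apply: contra uNU => eq_dim.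
have /eqP-> : U == (U + <[u]>)%VS by rewrite eqEdim addvSl -(eqP eq_dim) leqnn.
by apply: (subvP (addvSr _ _)); exact: memv_line.
Qed.

Lemma fin_dim_inj V W (f : {linear W -> V}) :
  injective f -> fin_dim V -> fin_dim W.
Proof.
move=> inj_f [d [g /bij_inj inj_g]].
have [U UE] := exists_vspace_image (g \o f)%FUN.
by exists (\dim U); apply: has_dim_vspace UE; exact: inj_comp.
Qed.

Lemma dimK_inj_surj V W (f : {linear W -> V}) :
    injective f -> fin_dim V -> (dimK V <= dimK W)%N ->
  forall v, exists w, f w = v.
Proof.
move=> inj_f /dimKP[g bij_g] le_d v.
have inj_gf : injective (g \o f)%FUN by apply: inj_comp => //; exact: bij_inj.
have [U UE] := exists_vspace_image (g \o f)%FUN.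
have dW := dimKE (has_dim_vspace inj_gf UE).
have /eqP UT : U == fullv by rewrite eqEdim subvf dim_rV -dW.
have /UE[w /(bij_inj bij_g) wE] : g v \in U by rewrite UT memvf.
by exists w.
Qed.

Lemma dimK_short_exact Z X V (i : {linear Z -> X}) (q : {linear X -> V}) :
  short_exact i q -> fin_dim X -> fin_dim V -> dimK X = (dimK Z + dimK V)%N.
Proof.
move=> [inj_i q_surj ker_q] /dimKP[f bij_f] /dimKP[g bij_g].
have [f' [fK f'K]] := linear_inverse bij_f.
pose h : {linear _ -> _} := (g \o (q \o f'))%FUN.
have hZ : has_dim Z (\dim (lker (linfun h))).
  apply: (@has_dim_vspace _ _ _ (f \o i)%FUN) => [|u].
    by apply: inj_comp => //; exact: bij_inj.
  rewrite memv_ker lfunE /=; split=> [/eqP gq0|[z <-]].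
    have /ker_q[z zE] : q (f' u) = 0.
      by apply: (bij_inj bij_g); rewrite gq0 linear0.
    by exists z; rewrite /= zE f'K.
  by rewrite /= fK (proj2 (ker_q _)) ?linear0 //; exists z.
have := limg_ker_dim (linfun h) fullv.
rewrite capfv (dimKE hZ) dim_rV => dimE; rewrite -[LHS]dimE; congr (_ + _)%N.
suff -> : limg (linfun h) = fullv by exact: dim_rV.
apply/vspaceP => v; rewrite memvf; case: bij_g => g' gK g'K.
have [x xE] := q_surj (g' v).
by apply/memv_imgP; exists (f x); rewrite ?memvf // lfunE /= fK xE g'K.
Qed.

Lemma dimK_eq0 V : fin_dim V -> dimK V = 0%N <-> zero_module V.
Proof.
move=> /dimKP[f bij_f]; split=> [d0 x|V0].
  apply: (bij_inj bij_f); move: (f x) (f 0); rewrite d0 => u v.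
  by rewrite [u]thinmx0 [v]thinmx0.
apply/eqP; rewrite -leqn0 leqNgt; apply/negP => d_gt0.
case: bij_f => g _ gK; pose i := Ordinal d_gt0.
have /rowP/(_ i)/eqP : delta_mx 0 i = 0 :> 'rV[K]_(dimK V).
  by rewrite -[LHS]gK (V0 (g _)) linear0.
by rewrite !mxE !eqxx oner_eq0.
Qed.

Lemma fin_dim_basis V : fin_dim V ->
  exists b : 'I_(dimK V) -> V,
    forall x, exists! c : 'I_(dimK V) -> K, x = \sum_i c i *: b i.
Proof.
move=> /dimKP[f bij_f]; have [g [fK gK]] := linear_inverse bij_f.
have sumE c : g (\row_i c i) = \sum_i c i *: g (delta_mx 0 i).
  rewrite [\row__ _]row_sum_delta linear_sum; apply: eq_bigr => i _.
  by rewrite linearZ mxE.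
exists (fun i => g (delta_mx 0 i)) => x; exists (f x 0); split.
  by rewrite -sumE -[LHS]fK; congr (g _); apply/rowP => i; rewrite mxE.
move=> c; rewrite -sumE => ->; rewrite gK.
by apply/funext => i; rewrite mxE.
Qed.

Lemma has_dim_basis V d (b : 'I_d -> V) :
    (forall x, exists! c : {ffun 'I_d -> K}, x = \sum_i c i *: b i) ->
  has_dim V d.
Proof.
move=> bP.
have [|g gE] := @exists_linear K 'rV_d V (fun r => \sum_i r 0 i *: b i).
  move=> a x y; rewrite scaler_sumr -big_split; apply: eq_bigr => i _.
  by rewrite !mxE scalerDl scalerA.
suff /linear_inverse[f [gK fK]] : bijective g by exists f; exists g.
have /(_ _)/cid-/all_sig[h hE] : forall x, exists c : 'rV_d, x = g c.
  move=> x; have [c [-> _]] := bP x; exists (\row_i c i); rewrite gE.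
  by apply: eq_bigr => i _; rewrite mxE.
exists h => [r|x]; last by rewrite -hE.
have [c [_ c_uniq]] := bP (g r).
have cE (s : 'rV_d) : g r = g s -> c = [ffun i => s 0 i].
  move=> rs; apply: c_uniq; rewrite rs gE; apply: eq_bigr => i _.
  by rewrite ffunE.
have /ffunP eq_c : [ffun i => h (g r) 0 i] = [ffun i => r 0 i].
  by rewrite -(cE _ (hE (g r))) -(cE r erefl).
by apply/rowP => i; have := eq_c i; rewrite !ffunE.
Qed.

End Dimension.

(** * Indecomposable modules *)

Section Indecomposable.
Variable R : nzRingType.
Implicit Types M P : lmodType R.

Lemma linear_iter M (t : {linear M -> M}) k : linear (iter k t).
Proof. by elim: k => // k IHk a x y /=; rewrite IHk linearP. Qed.

Lemma indecomposable_idempotent P (e : {linear P -> P}) :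
    indecomposable P -> (forall x, e (e x) = e x) ->
  (forall x, e x = x) \/ (forall x, e x = 0).
Proof.
move=> [_ indP] ee.
have [|e' e'E] := @exists_linear R P P (fun x => x - e x).
  by move=> a x y; rewrite linearP scalerBr opprD addrACA.
have [|f fE] := @exists_linear_factor R _ _ _ (ker_incl e) e' (@ker_incl_inj _ _ _ e).
  by move=> x; apply/ker_inclP; rewrite e'E linearB ee subrr.
have [|g gE] := @exists_linear_factor R _ _ _ (ker_incl e') e (@ker_incl_inj _ _ _ e').
  by move=> x; apply/ker_inclP; rewrite e'E ee subrr.
have [|h hE] := @exists_linear R P (ker e * ker e')%type (fun x => (f x, g x)).
  by move=> a x y; rewrite !linearP.
have e_incl' z : e (ker_incl e' z) = ker_incl e' z.
  by apply/esym/eqP; rewrite -subr_eq0 -e'E ker_inclK.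
have [|f0|g0] := indP (ker e) (ker e').
- exists h, (fun z => ker_incl e z.1 + ker_incl e' z.2) => [x|[z z']] /=.
    by rewrite hE fE gE e'E subrK.
  rewrite hE; congr pair.
    apply: (@ker_incl_inj _ _ _ e); rewrite fE e'E linearD ker_inclK add0r e_incl'.
    exact: addrK.
  by apply: (@ker_incl_inj _ _ _ e'); rewrite gE linearD ker_inclK add0r e_incl'.
- left=> x; apply/esym/eqP; rewrite -subr_eq0 -e'E -fE (f0 (f x)).
  by rewrite linear0.
- by right=> x; rewrite -gE (g0 (g x)) linear0.
Qed.

(** Fitting's lemma: iterating [t^k = t^(k+1) s] gives [t^k = t^(2k) s^k], so
    [t^k s^k] is an idempotent, and it acts as the identity on the image of [t^k].
    If it is [1] then [t] is invertible, and if it is [0] then so is [t^k]. *)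
Lemma fitting P (t s : {linear P -> P}) k : indecomposable P ->
    (forall x, t (s x) = s (t x)) ->
    (forall x, iter k t x = iter k.+1 t (s x)) ->
  bijective t \/ (forall x, iter k t x = 0).
Proof.
move=> indP ts tk.
have tis i x : iter i t (s x) = s (iter i t x).
  by elim: i => //= i ->; rewrite ts.
have tisj i j x : iter i t (iter j s x) = iter j s (iter i t x).
  by elim: j => //= j IHj; rewrite tis IHj.
have tks m x : iter k t x = iter (k + m) t (iter m s x).
  elim: m x => [|m IHm] x; first by rewrite addn0.
  by rewrite IHm addnS addnC iterD tk -iterD addnS.
have [|e eE] := @exists_linear R P P (fun x => iter k t (iter k s x)).
  by move=> a x y; rewrite !linear_iter.
have etk x : e (iter k t x) = iter k t x.
  by rewrite eE -tisj -iterD -tks.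
have [|e1|e0] := indecomposable_idempotent (e := e) indP.
- by move=> x; rewrite (eE x) etk.
- left; case: k tk {tks etk} eE => [|k] tk eE.
    by exists s => x; rewrite -?ts; exact: esym (tk x).
  exists (fun x => iter k t (iter k.+1 s x)) => x.
    by rewrite -[t x]/(iter 1 t x) -tisj -iterD addn1 -eE e1.
  by rewrite -[LHS]/(iter k.+1 t _) -eE e1.
- by right=> x; rewrite -etk e0.
Qed.

End Indecomposable.

(** * Modules over a finite-dimensional algebra *)

Section RestrictScalars.
Variables (K : fieldType) (A : falgType K).
Implicit Types M N P X Z : lmodType A^c.

Definition kscal (c : K) : A^c := (c%:A : A).

Lemma kscalC c (a : A^c) : a * kscal c = kscal c * a.
Proof.
rewrite -[LHS]/((c%:A : A) * (a : A)) -[RHS]/((a : A) * (c%:A : A)).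
by rewrite -scalerAl mul1r -scalerAr mulr1.
Qed.

Lemma kscalM a b : kscal (a * b) = kscal a * kscal b.
Proof.
rewrite -[RHS]/((b%:A : A) * (a%:A : A)) -scalerAl mul1r scalerA.
by rewrite /kscal mulrC.
Qed.

Lemma kscal1 : kscal 1 = 1.
Proof. by rewrite /kscal scale1r. Qed.

Fact kscal_zmod_morphism : zmod_morphism kscal.
Proof. by move=> a b; exact: scalerBl. Qed.
HB.instance Definition _ :=
  GRing.isZmodMorphism.Build K A^c kscal kscal_zmod_morphism.

(** The same abelian group as [M], as a vector space over [K]; a separate name
    keeps its scalar action apart from that of the algebra. *)
Definition resK M : Type := M.
HB.instance Definition _ M := GRing.Zmodule.on (resK M).

Section Scale.
Variable M : lmodType A^c.

Definition resK_scale (c : K) (x : resK M) : resK M := kscal c *: (x : M).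

Fact resK_scaleA a b x : resK_scale a (resK_scale b x) = resK_scale (a * b) x.
Proof.
by rewrite /resK_scale scalerA -kscalM.
Qed.

Fact resK_scale1 : left_id 1 resK_scale.
Proof. by move=> x; rewrite /resK_scale kscal1; exact: (scale1r (x : M)). Qed.

Fact resK_scaleDr : right_distributive resK_scale +%R.
Proof. by move=> a x y; exact: (scalerDr (kscal a) (x : M) (y : M)). Qed.

Fact resK_scaleDl x : {morph resK_scale^~ x : a b / a + b}.
Proof.
move=> a b; rewrite /resK_scale raddfD.
exact: (scalerDl (x : M) (kscal a) (kscal b)).
Qed.

HB.instance Definition _ := GRing.Zmodule_isLmodule.Build K (resK M)
  resK_scaleA resK_scale1 resK_scaleDr resK_scaleDl.

Lemma resK_scaleE (c : K) (x : resK M) : c *: x = kscal c *: (x : M).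
Proof. by []. Qed.

End Scale.

Definition resK_fun M N (f : {linear M -> N}) : resK M -> resK N := f.

Fact resK_fun_linear M N (f : {linear M -> N}) : linear (resK_fun f).
Proof. by move=> c x y; rewrite resK_scaleE [LHS](linearP f). Qed.
HB.instance Definition _ M N (f : {linear M -> N}) :=
  GRing.isLinear.Build K (resK M) (resK N) *:%R (resK_fun f) (resK_fun_linear f).

Definition fd_mod M : Prop := fin_dim (resK M).

Lemma fd_mod_inj M N (f : {linear N -> M}) : injective f -> fd_mod M -> fd_mod N.
Proof. by move=> inj_f; apply: (@fin_dim_inj _ _ _ (resK_fun f)). Qed.

Lemma resK_short_exact Z X M (i : {linear Z -> X}) (q : {linear X -> M}) :
  short_exact i q -> short_exact (resK_fun i) (resK_fun q).
Proof. by []. Qed.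

Lemma fd_mod_ffun (I : finType) : fd_mod {ffun I -> (A^c)^o}.
Proof.
have [|f fE] := @exists_linear K (resK {ffun I -> (A^c)^o}) {ffun I -> A}
    (fun x => x).
  move=> c x y; apply/ffunP => i; rewrite !ffunE; congr (_ + _).
  rewrite -[LHS]/((x i : A) * (c%:A : A)).
  by rewrite -scalerAr mulr1.
apply: (@fin_dim_inj _ _ _ f); last exact: fin_dim_vect.
by move=> x y; rewrite !fE.
Qed.

Definition fix_defect (e : A^c) M (x : resK M) : resK M := x - e *: (x : M).

Fact fix_defect_linear e M : linear (@fix_defect e M).
Proof.
move=> c x y; rewrite /fix_defect !resK_scaleE scalerBr scalerDr opprD.
by rewrite !scalerA kscalC addrACA.
Qed.
HB.instance Definition _ e M :=
  GRing.isLinear.Build K (resK M) (resK M) *:%R (@fix_defect e M)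
    (@fix_defect_linear e M).

Lemma fix_defect_eq0 e M (x : M) : @fix_defect e M x = 0 <-> e *: x = x.
Proof.
rewrite /fix_defect; split=> [/eqP|ex]; last by rewrite [X in _ - X]ex subrr.
by rewrite subr_eq0 => /eqP/esym.
Qed.

(** In terms of right modules this is [M e], that is, [Hom(eA, M)], when [e] is
    idempotent. *)
Definition fixed (e : A^c) M : lmodType K := ker (@fix_defect e M).
Definition fixed_incl e M : {linear fixed e M -> resK M} := ker_incl _.
Arguments fixed_incl {e M}.
Definition fix_dim (e : A^c) M : nat := dimK (fixed e M).

Lemma fixed_incl_inj e M : injective (@fixed_incl e M).
Proof. exact: ker_incl_inj. Qed.

Lemma fixed_inclK e M (z : fixed e M) :
  e *: (fixed_incl z : M) = fixed_incl z.
Proof. exact/fix_defect_eq0/(ker_inclK z). Qed.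

Lemma fixed_inclP e M (x : M) :
  e *: x = x <-> exists z : fixed e M, fixed_incl z = x.
Proof.
split=> [ex|[z <-]]; last exact: fixed_inclK.
exact/(ker_inclP (@fix_defect e M))/fix_defect_eq0.
Qed.

Lemma fin_dim_fixed e M : fd_mod M -> fin_dim (fixed e M).
Proof. by apply: fin_dim_inj; exact: fixed_incl_inj. Qed.

Lemma exists_fixed_map e M N (f : {linear M -> N}) :
  exists g : {linear fixed e M -> fixed e N},
    forall z, fixed_incl (g z) = f (fixed_incl z).
Proof.
apply: (@exists_linear_factor _ _ _ _ _ (resK_fun f \o @fixed_incl e M)%FUN).
  exact: fixed_incl_inj.
move=> z; apply/fixed_inclP.
exact: etrans (esym (linearZ_LR f e _)) (congr1 f (fixed_inclK z)).
Qed.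

Lemma fix_dim_short_exact e Z X M (i : {linear Z -> X}) (q : {linear X -> M}) :
    e * e = e -> short_exact i q -> fd_mod X -> fd_mod M ->
  fix_dim e X = (fix_dim e Z + fix_dim e M)%N.
Proof.
move=> ee [inj_i q_surj ker_q] fdX fdM.
have [j jE] := exists_fixed_map e i; have [p pE] := exists_fixed_map e q.
apply: (@dimK_short_exact _ _ _ _ j p); try exact: fin_dim_fixed.
split=> [z z' jz|m|x].
- by apply/fixed_incl_inj/inj_i; rewrite -!jE jz.
- have [x xE] := q_surj (fixed_incl m).
  have [|z zE] := (fixed_inclP e (e *: x)).1; first by rewrite scalerA ee.
  exists z; apply: fixed_incl_inj.
  by rewrite pE zE linearZ xE; exact: fixed_inclK.
- split=> [px|[z <-]]; last first.
    apply: fixed_incl_inj; rewrite pE jE linear0.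
    by apply/ker_q; exists (fixed_incl z).
  have /ker_q[z zE] : q (fixed_incl x) = 0 by rewrite -pE px linear0.
  have [|z' z'E] := (fixed_inclP e z).1.
    by apply: inj_i; rewrite linearZ zE; exact: fixed_inclK.
  by exists z'; apply: fixed_incl_inj; rewrite jE z'E.
Qed.

Lemma fix_dim_bij e M N (f : {linear M -> N}) :
  bijective f -> fd_mod N -> fix_dim e M = fix_dim e N.
Proof.
move=> bij_f fdN; have [h [fK hK]] := linear_inverse bij_f.
have [g gE] := exists_fixed_map e f; have [k kE] := exists_fixed_map e h.
apply: (@dimK_bij _ _ _ g); last exact: fin_dim_fixed.
by exists k => z; apply: fixed_incl_inj; rewrite ?(gE, kE, fK, hK).
Qed.

End RestrictScalars.

Arguments fixed_incl {K A e M}.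

Section Endomorphisms.
Variables (K : fieldType) (A : falgType K).
Implicit Types M N P X Z : lmodType A^c.

Lemma exists_linear_comb (I : finType) M N (f : I -> {linear M -> N}) (c : I -> K) :
  exists g : {linear M -> N}, forall x, g x = \sum_i kscal A (c i) *: f i x.
Proof.
apply: exists_linear => a x y; rewrite scaler_sumr -big_split.
apply: eq_bigr => i _.
by rewrite linearP scalerDr !scalerA kscalC.
Qed.

(** The first nonzero coefficient of a linear dependency between the powers of
    [t] is invertible, which puts [t] in the situation of Fitting's lemma. *)
Lemma fitting_hom_dim P d (t : {linear P -> P}) :
    indecomposable P -> hom_dim P P d ->
  bijective t \/ exists k, forall x, iter k t x = 0.
Proof.
move=> indP [b bP].
have iter_lin k : exists f : {linear P -> P}, f =1 iter k t.
  by apply: exists_linear; exact: linear_iter.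
have /(_ _)/cid-/all_sig[c cE] k : exists c : {ffun 'I_d -> K},
    forall x, iter k t x = \sum_(i < d) kscal A (c i) *: b i x.
  have [f fE] := iter_lin k; have [c [cE _]] := bP f.
  by exists c => x; rewrite -fE cE.
pose L : 'M[K]_(d.+1, d) := \matrix_(i, j) c i j.
have [u uL u_neq0] : exists2 u : 'rV[K]_d.+1, u *m L = 0 & u != 0.
  have : kermx L != 0.
    rewrite kermx_eq0 /row_free neq_ltn (leq_ltn_trans (rank_leq_col L)) //.
  case/rowV0Pn=> u /sub_kermxP uL u_neq0; by exists u.
have sum0 x : \sum_(i < d.+1) kscal A (u 0 i) *: iter i t x = 0.
  transitivity (\sum_(j < d) kscal A ((u *m L) 0 j) *: b j x).
    rewrite (eq_bigr (fun i : 'I_d.+1 => \sum_(j < d)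
        kscal A (u 0 i * L i j) *: b j x)); last first.
      move=> i _; rewrite cE scaler_sumr; apply: eq_bigr => j _.
      by rewrite scalerA mxE kscalM.
    rewrite exchange_big; apply: eq_bigr => j _.
    by rewrite mxE /= -scaler_suml; congr (_ *: _); rewrite raddf_sum.
  by rewrite uL big1 // => j _; rewrite mxE raddf0 scale0r.
have /(_ _)/cid-/all_sig[f fE] := iter_lin.
have [i0 ui0] : exists i, u 0 i != 0 by apply/rV0Pn.
case: (@arg_minnP _ i0 (fun i => u 0 i != 0) (fun i : 'I_d.+1 => val i) ui0) => k uk mink.
pose c' (i : 'I_d.+1) := if (k < i)%N then - (u 0 k)^-1 * u 0 i else 0.
have [s sE] := exists_linear_comb (fun i : 'I_d.+1 => f (i - k.+1)%N) c'.
have fs j x : f j (s x) = \sum_(i < d.+1) kscal A (c' i) *: iter (j + (i - k.+1)) t x.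
  rewrite sE linear_sum; apply: eq_bigr => i _.
  by rewrite linearZ_LR !fE iterD.
suff [|kt0] : bijective t \/ (forall x, iter k t x = 0); [by left | by right; exists k |].
apply: (fitting (s := s)) => // x.
  rewrite -[t (s x)]/(iter 1 t (s x)) -fE fs sE; apply: eq_bigr => i _.
  by rewrite fE add1n iterSr.
rewrite -[RHS](fE k.+1 (s x)) fs.
have := sum0 x; rewrite (bigD1 k) //= => /(congr1 (fun y => kscal A (u 0 k)^-1 *: y)).
rewrite scalerDr scalerA -kscalM mulVf // kscal1 scale1r scaler0.
move/eqP; rewrite addr_eq0 => /eqP->.
rewrite [RHS](bigD1 k) //= /c' ltnn raddf0 scale0r add0r scaler_sumr -sumrN.
apply: eq_bigr => i ne_ik; rewrite scalerA -kscalM -scaleNr -raddfN -mulNr.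
case: ltnP => [lt_ki|le_ik]; first by rewrite -iterS -addSn subnKC.
suff /eqP-> : u 0 i == 0 by rewrite mulr0 !raddf0 !scale0r.
apply: contraT => /mink le_ki; case/negP: ne_ik.
by rewrite -val_eqE eqn_leq le_ik.
Qed.

(** In an endomorphism ring whose elements are all bijective or nilpotent, two
    nilpotent elements [a] and [b] cannot add up to a bijective one: normalise the
    sum to the identity, take [y <> 0] in the image of the last nonzero power of
    [a]; then [b y = y]. *)
Lemma bijective_add P d (u t1 t2 : {linear P -> P}) :
    indecomposable P -> hom_dim P P d -> bijective u ->
    (forall x, u x = t1 x + t2 x) ->
  bijective t1 \/ bijective t2.
Proof.
move=> indP dP bij_u uE; have [v [uK vK]] := linear_inverse bij_u.
have bij_comp_v (t : {linear P -> P}) : bijective (v \o t)%FUN -> bijective t.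
  move=> bij_vt; apply: (eq_bij (bij_comp bij_u bij_vt)) => x.
  by rewrite /= vK.
have [/bij_comp_v|[k ak]] := fitting_hom_dim (v \o t1)%FUN indP dP; first by left.
have [/bij_comp_v|[l bl]] := fitting_hom_dim (v \o t2)%FUN indP dP; first by right.
pose a := (v \o t1)%FUN; pose b := (v \o t2)%FUN.
have abE x : a x + b x = x by rewrite -[LHS]/(v (t1 x) + v (t2 x)) -linearD -uE uK.
case: indP => nzP _; case: nzP => x.
elim: k ak => [|k IHk] ak; first exact: ak x.
apply: IHk => y; have by_y : b (iter k a y) = iter k a y.
  by rewrite -[RHS]abE -[a (iter k a y)]/(iter k.+1 a y) [iter k.+1 a y]ak add0r.
have bm_y m : iter m b (iter k a y) = iter k a y.
  by elim: m => // m IHm; rewrite iterS IHm by_y.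
exact: etrans (esym (bm_y l)) (bl _).
Qed.

Lemma bijective_sum (I : Type) (r : seq I) P d (u : {linear P -> P})
    (t : I -> {linear P -> P}) :
    indecomposable P -> hom_dim P P d -> bijective u ->
    (forall x, u x = \sum_(i <- r) t i x) ->
  exists i, bijective (t i).
Proof.
move=> indP dP; elim: r u => [|i r IHr] u bij_u uE.
  case: indP => nzP _; case: nzP => x; apply: (bij_inj bij_u).
  by rewrite linear0 uE big_nil.
have [|w wE] := @exists_linear _ P P (fun x => \sum_(i <- r) t i x).
  by move=> a x y; rewrite scaler_sumr -big_split; apply: eq_bigr => j _; exact: linearP.
have [||bij_w] := bijective_add (t1 := t i) (t2 := w) indP dP bij_u.
- by move=> x; rewrite uE big_cons wE.
- by exists i.
- exact: IHr bij_w wE.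
Qed.

(** The right module [P] is a direct summand of [A] through [f : P -> A] and
    [a |-> p a]. So [P] is [eA] for the idempotent [e = f p], and homomorphisms from
    [P] to [M] are the elements of [M e], the images of [p]. *)
Definition is_coord P (p : P) (f : {linear P -> (A^c)^o}) : Prop :=
  forall y, (f y : A^c) *: p = y.

(** Being projective, [P] is a direct summand of a free module, which yields
    endomorphisms [t_k] of [P] factoring through [A], of which finitely many sum to
    an endomorphism fixing a given [x <> 0]. Such a sum is not nilpotent, hence is
    bijective, and then some [t_k] is bijective. *)
Lemma exists_coord P d : projective P -> indecomposable P -> hom_dim P P d ->
  exists p f, @is_coord P p f.
Proof.
move=> projP indP dP.
have [q qE q_surj] := exists_free_cover P.
have [s sK] := projP _ _ q idfun q_surj.
have [nzP _] := indP; have [x x_neq0] : exists x : P, x <> 0 by exact/existsNP.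
have /(_ _)/cid-/all_sig[c cE] (k : P) :
    exists c : {linear P -> (A^c)^o}, forall y, c y = (s y)@_k.
  by apply: exists_linear => a y z; rewrite linearP mcoeffD mcoeffZ.
have /(_ _)/cid-/all_sig[t tE] (k : P) :
    exists t : {linear P -> P}, forall y, t y = (c k y : A^c) *: k.
  by apply: exists_linear => a y z; rewrite linearP scalerDl scalerA.
have [u uE] : exists u : {linear P -> P}, forall y, u y = \sum_(k <- msupp (s x)) t k y.
  apply: exists_linear => a y z; rewrite scaler_sumr -big_split.
  by apply: eq_bigr => j _; exact: linearP.
have ux : u x = x.
  rewrite uE -[RHS](sK x) qE; apply: eq_bigr => k _.
  by rewrite tE cE.
have [bij_u|[k uk0]] := fitting_hom_dim u indP dP; last first.
  case: x_neq0; rewrite -[RHS](uk0 x).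
  by elim: k {uk0} => //= k <-; rewrite ux.
have [k bij_tk] := bijective_sum indP dP bij_u uE.
have [v [tK vK]] := linear_inverse bij_tk.
by exists k, (c k \o v)%FUN => y; rewrite -[RHS]vK tE.
Qed.

Section Coord.
Variables (P : lmodType A^c) (p : P) (f : {linear P -> (A^c)^o}).
Hypothesis pf : is_coord p f.

Let e : A^c := f p.

Lemma coord_idem : e * e = e.
Proof. by rewrite -[LHS](linearZ_LR f) pf. Qed.

Lemma hom_dim_fix_dim M d : hom_dim P M d -> fix_dim e M = d.
Proof.
move=> [b bP]; apply: dimKE.
have /(_ _)/cid-/all_sig[b' b'E] i : exists z : fixed e M, fixed_incl z = b i p.
  by apply/fixed_inclP; rewrite -linearZ_LR pf.
have sumE (c : {ffun 'I_d -> K}) :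
    fixed_incl (\sum_i c i *: b' i) = \sum_i kscal A (c i) *: b i p.
  rewrite linear_sum; apply: eq_bigr => i _; rewrite linearZ_LR b'E.
  exact: resK_scaleE.
apply: (@has_dim_basis _ _ _ b') => z.
have [|g gE] := @exists_linear _ P M (fun y => (f y : A^c) *: (fixed_incl z : M)).
  by move=> a x y; rewrite linearP scalerDl scalerA.
have [c [cE c_uniq]] := bP g; exists c; split.
  by apply: fixed_incl_inj; rewrite sumE -cE gE; apply/esym/fixed_inclK.
move=> c' zE; apply: c_uniq => y; rewrite gE zE sumE scaler_sumr.
apply: eq_bigr => i _; rewrite scalerA kscalC -scalerA -linearZ_LR pf.
by [].
Qed.

End Coord.
End Endomorphisms.

(** * Dimension vectors and the Cartan lattice *)

Section CartanLattice.
Variables (K : fieldType) (A : falgType K) (n : nat).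
Variables (P : 'I_n -> lmodType A^c) (C : 'M[int]_n).
Hypotheses (hP : complete_indec_projectives P) (hC : cartan_matrix P C).
Variables (p : forall i, P i) (f : forall i, {linear P i -> (A^c)^o}).
Hypothesis pf : forall i, is_coord (p i) (f i).
Implicit Types M X Y Z : lmodType A^c.

Let e i : A^c := f i (p i).

(** The numbers [dim Hom(P_i, M)] form the dimension vector of [M], and the columns
    of [C] are the dimension vectors of the [P_j]; so the lattice that they span
    is the image of the Grothendieck group of finitely generated projectives. *)
Definition in_cartan_lattice M : Prop :=
  exists c : 'I_n -> int, forall i, (fix_dim (e i) M)%:Z = \sum_j C i j * c j.

Lemma fix_dim_cartan i j : (fix_dim (e i) (P j))%:Z = C i j.
Proof. by have [d dE ->] := hC i j; rewrite (hom_dim_fix_dim (@pf i) dE). Qed.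

Lemma in_cartan_lattice_short_exact Z X M (i : {linear Z -> X}) (q : {linear X -> M}) :
    short_exact i q -> fd_mod X -> fd_mod M ->
  in_cartan_lattice X ->
  in_cartan_lattice Z <-> in_cartan_lattice M.
Proof.
move=> exq fdX fdM [c cE].
have dimE k : (fix_dim (e k) X)%:Z = (fix_dim (e k) Z)%:Z + (fix_dim (e k) M)%:Z.
  by rewrite -PoszD (fix_dim_short_exact (coord_idem (@pf k)) exq).
split=> -[c' c'E]; exists (fun j => c j - c' j) => k.
all: under eq_bigr do rewrite mulrBr.
all: rewrite sumrB -cE -c'E dimE.
  by rewrite addrC addKr.
by rewrite addrK.
Qed.

(** Splitting off direct summands lowers the dimension, so [M] is a finite direct
    sum of indecomposable projectives, each of them isomorphic to some [P_j]. *)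
Lemma projective_in_cartan_lattice M :
  fd_mod M -> projective M -> in_cartan_lattice M.
Proof.
have [projP _ complP] := hP.
have [m] := ubnP (dimK (resK M)); elim: m M => // m IHm M lt_m fdM projM.
have [zM|nzM] := pselect (zero_module M).
  exists (fun _ => 0) => i; rewrite big1 => [|j _]; last exact: mulr0.
  suff -> : fix_dim (e i) M = 0%N by [].
  apply/dimK_eq0; first exact: fin_dim_fixed.
  by move=> z; apply: fixed_incl_inj; rewrite linear0; exact: zM.
have [indM|nindM] := pselect (indecomposable M).
  have [j [h bij_h]] := complP M projM indM.
  exists (fun k => (k == j)%:Z) => i.
  have fdPj : fd_mod (P j).
    by have [g [_ gK]] := linear_inverse bij_h; exact: fd_mod_inj (can_inj gK) fdM.
  rewrite (fix_dim_bij _ bij_h fdPj) fix_dim_cartan (bigD1 j) //= eqxx mulr1.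
  by rewrite big1 ?addr0 // => k /negPf->; rewrite mulr0.
have [X [Y [[h bij_h] nzX nzY]]] : exists X Y, [/\ mod_iso M (X * Y)%type,
    ~ zero_module X & ~ zero_module Y].
  apply: contrapT => nXY; apply: nindM; split=> // X Y isoM.
  have [?|nzX] := pselect (zero_module X); first by left.
  have [?|nzY] := pselect (zero_module Y); first by right.
  by case: nXY; exists X, Y.
have [j exq] := short_exact_bij_l bij_h (short_exact_pair X Y).
have [g [hK gK]] := linear_inverse bij_h.
have fdX : fd_mod X by case: exq => inj_j _ _; exact: fd_mod_inj inj_j fdM.
have fdY : fd_mod Y.
  apply: (fd_mod_inj (f := (g \o @pairr _ X Y)%FUN)) fdM.
  by apply: inj_comp; [exact: can_inj gK | move=> x y []].
have projX : projective X.
  apply: (projective_retract (s := (g \o @pairl _ X Y)%FUN) (r := (fst \o h)%FUN)) projM.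
  by move=> x; rewrite /= gK.
have projY : projective Y.
  apply: (projective_retract (s := (g \o @pairr _ X Y)%FUN) (r := (snd \o h)%FUN)) projM.
  by move=> x; rewrite /= gK.
have dimE : dimK (resK M) = (dimK (resK X) + dimK (resK Y))%N.
  exact: dimK_short_exact (resK_short_exact exq) fdM fdY.
have dimX : (0 < dimK (resK X))%N.
  by rewrite lt0n; apply/eqP => /(dimK_eq0 fdX).1; exact: nzX.
have dimY : (0 < dimK (resK Y))%N.
  by rewrite lt0n; apply/eqP => /(dimK_eq0 fdY).1; exact: nzY.
have [|cX cXE] := IHm X _ fdX projX.
  by rewrite -ltnS (leq_trans _ lt_m) // dimE ltnS -addn1 leq_add2l.
have [|cY cYE] := IHm Y _ fdY projY.
  by rewrite -ltnS (leq_trans _ lt_m) // dimE ltnS -add1n leq_add2r.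
exists (fun k => cX k + cY k) => i.
rewrite (fix_dim_short_exact (coord_idem (@pf i)) exq) // PoszD cXE cYE -big_split.
by apply: eq_bigr => k _; rewrite mulrDr.
Qed.

(** Covering by free modules of finite rank keeps every syzygy finite-dimensional,
    so that dimension vectors add up along the resolution. *)
Lemma all_pd_in_cartan_lattice l M :
  fd_mod M -> all_pd_le l M -> in_cartan_lattice M.
Proof.
elim: l M => [|l IHl] M fdM; first exact: projective_in_cartan_lattice.
move=> pdM; have [b bP] := fin_dim_basis fdM.
pose Y : lmodType A^c := {ffun 'I_(dimK (resK M)) -> (A^c)^o}.
have [|q qE] := @exists_linear _ Y M (fun y => \sum_i (y i : A^c) *: (b i : M)).
  move=> a x y; rewrite scaler_sumr -big_split; apply: eq_bigr => i _.
  by rewrite !ffunE scalerDl scalerA.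
have q_surj m : exists y, q y = m.
  have [c [-> _]] := bP m; exists [ffun i => kscal A (c i) : (A^c)^o]; rewrite qE.
  by apply: eq_bigr => i _; rewrite ffunE.
have exq := ker_short_exact q_surj.
have fdY : fd_mod Y by exact: fd_mod_ffun.
have projY : projective Y by exact: projective_ffun.
apply/(in_cartan_lattice_short_exact exq fdY fdM).
  exact: projective_in_cartan_lattice.
apply: IHl; last exact: pdM projY exq.
by apply: fd_mod_inj fdY; exact: ker_incl_inj.
Qed.

End CartanLattice.

(** * Duality *)

(** Here [V] is a direct summand of [T], and [W] is the part of the dual of [T]
    that corresponds to the dual of [V]. *)
Lemma dimK_dual (K : fieldType) (V W : lmodType K) (T : vectType K)
    (s : {linear V -> T}) (r : {linear T -> V}) (i : {linear W -> 'Hom(T, K^o)}) :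
    cancel s r -> injective i ->
    (forall phi : 'Hom(T, K^o),
      (forall a, phi (s (r a)) = phi a) <-> exists w, i w = phi) ->
  fin_dim V -> dimK W = dimK V.
Proof.
move=> sK inj_i imi /dimKP[g bij_g]; have [h [gK hK]] := linear_inverse bij_g.
apply: dimKE.
have [|t tE] := @exists_linear _ W 'rV[K]_(dimK V)
    (fun w => \row_k i w (s (h (delta_mx 0 k)))).
  by move=> a x y; apply/rowP => k; rewrite !mxE linearP add_lfunE scale_lfunE.
have sumE (u : 'rV[K]_(dimK V)) (w : W) : i w (s (h u)) = \sum_k u 0 k * t w 0 k.
  rewrite [u in LHS]row_sum_delta !linear_sum; apply: eq_bigr => k _.
  by rewrite tE mxE !linearZ.
have ex_w (c : 'rV[K]_(dimK V)) : exists w, forall a, i w a = \sum_k g (r a) 0 k * c 0 k.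
  have [|l lE] := @exists_linear K T K^o (fun a => \sum_k g (r a) 0 k * c 0 k).
    move=> a x y; rewrite scaler_sumr -big_split; apply: eq_bigr => k _.
    by rewrite !linearP !mxE mulrDl -mulrA.
  have [|w wE] := (imi (linfun l)).1; first by move=> a; rewrite !lfunE /= !lE sK.
  by exists w => a; rewrite wE lfunE /= lE.
have [c cE] := choice ex_w.
exists t, c => [w|v].
  apply: inj_i; apply/lfunP => a; rewrite cE.
  rewrite -[RHS]((imi (i w)).2 _ a); last by exists w.
  by rewrite -[r a in RHS]gK sumE.
apply/rowP => k; rewrite tE mxE cE sK hK (bigD1 k) //= mxE !eqxx mul1r.
by rewrite big1 ?addr0 // => l /negPf lk; rewrite mxE eqxx lk mul0r.
Qed.

Section Dual.
Variables (K : fieldType) (A : falgType K).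

Lemma Kdual_kscal c (phi : Kdual A) :
  kscal A c *: phi = c *: (phi : 'Hom(A, K^o)) :> 'Hom(A, K^o).
Proof.
apply/lfunP => x; rewrite scale_lfunE -linearZ -[c *: x]mul1r -scalerAr scalerAl.
exact: Kdual_scaleE.
Qed.

Lemma fd_mod_Kdual : fd_mod (Kdual A).
Proof.
have [|g gE] := @exists_linear K (resK (Kdual A)) 'Hom(A, K^o) (fun x => x).
  by move=> c phi psi; congr (_ + _); exact: Kdual_kscal.
apply: (fin_dim_inj (f := g)); last exact: fin_dim_vect.
by move=> x y; rewrite !gE.
Qed.

Definition codefect (e : A) (phi : Kdual A) : Kdual A := phi - (phi \o amulr e)%VF.

Lemma codefectE e phi x : codefect e phi x = phi x - phi (x * e).
Proof. by rewrite /codefect add_lfunE opp_lfunE comp_lfunE lfunE. Qed.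

Fact codefect_linear e : linear (codefect e).
Proof.
move=> a phi psi; apply/lfunP => x.
have scaleE (xi : Kdual A) y : (a *: xi) y = xi ((a : A) * y) by exact: Kdual_scaleE.
rewrite codefectE !add_lfunE !scaleE !codefectE mulrA opprD.
by rewrite addrACA opp_lfunE comp_lfunE [in RHS]lfunE.
Qed.
HB.instance Definition _ e :=
  GRing.isLinear.Build A^c (Kdual A) (Kdual A) *:%R (codefect e) (codefect_linear e).

(** The functionals that only depend on the component in [Ae], that is, the
    injective right module [D(Ae)]. *)
Definition dual_summand (e : A) : lmodType A^c := ker (codefect e).

Lemma codefect_eq0 e phi :
  codefect e phi = 0 <-> forall x, phi (x * e) = phi x.
Proof.
split=> [/lfunP phi_e x|phi_e].
  by have /eqP := phi_e x; rewrite codefectE lfunE subr_eq0 => /eqP/esym.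
by apply/lfunP => x; rewrite codefectE phi_e subrr lfunE.
Qed.

Lemma dual_summandE e (z : dual_summand e) x :
  ker_incl (codefect e) z (x * e) = ker_incl (codefect e) z x.
Proof. by have /codefect_eq0 := ker_inclK z. Qed.

Lemma fd_mod_dual_summand e : fd_mod (dual_summand e).
Proof. exact: fd_mod_inj (@ker_incl_inj _ _ _ (codefect e)) fd_mod_Kdual. Qed.

Lemma all_pd_dual_summand l e : e * e = e ->
  all_pd_le l (Kdual A) -> all_pd_le l (dual_summand e).
Proof.
move=> ee.
have [|t tE] := @exists_linear _ (Kdual A) (Kdual A) (fun phi => phi - codefect e phi).
  by move=> a x y; rewrite linearP scalerBr opprD addrACA.
have [|r rE] := @exists_linear_factor _ _ _ _ (ker_incl (codefect e)) t
    (@ker_incl_inj _ _ _ _).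
  move=> phi; apply/ker_inclP/codefect_eq0 => x; rewrite tE.
  by rewrite !add_lfunE !opp_lfunE !codefectE -!mulrA ee subrr subr0 subKr.
apply: (all_pd_le_retract (s := ker_incl (codefect e)) (r := r)) => z.
by apply: (@ker_incl_inj _ _ _ (codefect e)); rewrite rE tE ker_inclK subr0.
Qed.

(** If [P = e'A], the left side is the dimension of the dual of [e'Ae], and the
    right side is that of [e'Ae]. *)
Lemma fix_dim_dual_summand (P : lmodType A^c) (p : P) (f : {linear P -> (A^c)^o})
    (e : A^c) : is_coord p f -> e * e = e -> fd_mod P ->
  fix_dim (f p : A^c) (dual_summand e) = fix_dim e P.
Proof.
move=> pf ee fdP; pose e' : A := f p.
have [|s sE] := @exists_linear K (fixed e P) A (fun z => f (fixed_incl z)).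
  move=> c x y; rewrite linearP resK_scaleE linearP; congr (_ + _).
  rewrite -[LHS]/((f (fixed_incl x) : A) * (c%:A : A)).
  by rewrite -scalerAr mulr1.
have ex_r (a : A) : exists z : fixed e P, fixed_incl z = (e * (a : A^c)) *: p.
  by apply/fixed_inclP; rewrite scalerA mulrA ee.
have [r0 r0E] := choice ex_r.
have [|r rE] := @exists_linear K A (fixed e P) r0.
  move=> c a b; apply: fixed_incl_inj; rewrite linearP !r0E resK_scaleE.
  rewrite scalerA; apply: (etrans _ (scalerDl (p : P) _ _)); congr (_ *: _).
  rewrite mulrA -kscalC -mulrA -mulrDr; congr (_ * (_ + _)).
  rewrite -[RHS]/((a : A) * (c%:A : A)).
  by rewrite -scalerAr mulr1.
have srE a : s (r a) = e' * a * (e : A).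
  rewrite sE rE r0E linearZ_LR.
  by rewrite -[LHS]/(e' * ((a : A) * (e : A))) mulrA.
have eeA : (e : A) * (e : A) = e by exact: ee.
have e'e' : e' * e' = e' by exact: (coord_idem pf).
have [|i iE] := @exists_linear K (fixed (e' : A^c) (dual_summand e)) 'Hom(A, K^o)
    (fun z => ker_incl (codefect e) (fixed_incl z)).
  move=> c x y; rewrite linearP resK_scaleE linearP; congr (_ + _).
  exact: Kdual_kscal.
apply: (@dimK_dual _ _ _ _ s r i); last exact: fin_dim_fixed.
- move=> z; apply: fixed_incl_inj; rewrite rE r0E sE -scalerA pf.
  exact: fixed_inclK.
- move=> x y; rewrite !iE => xy; apply: fixed_incl_inj.
  exact: (@ker_incl_inj _ _ _ (codefect e)) xy.
- move=> phi; split=> [phi_sr|[z <-] a].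
    have [|z zE] := (ker_inclP (codefect e) phi).1.
      apply/codefect_eq0 => x; rewrite -phi_sr -[RHS]phi_sr !srE.
      by rewrite -!mulrA eeA.
    have [|w wE] := (fixed_inclP (e' : A^c) z).1.
      apply: (@ker_incl_inj _ _ _ (codefect e)); rewrite linearZ zE.
      apply/lfunP => x; rewrite [LHS]Kdual_scaleE -phi_sr -[RHS]phi_sr !srE.
      by rewrite !mulrA e'e'.
    by exists w; rewrite iE wE zE.
  rewrite iE srE dual_summandE -[in RHS](fixed_inclK z) linearZ_LR.
  exact: esym (Kdual_scaleE _ _ _).
Qed.

End Dual.

(** * Integrality and nonsingularity of the Cartan matrix *)

Section Cyclic.
Variables (R : nzRingType) (M : lmodType R) (n : M).

Definition cyclic_pred : {pred M} := [pred x | `[< exists b : R, b *: n = x >]].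

Fact cyclic_submod_closed : submod_closed cyclic_pred.
Proof.
split=> [|a x y]; first by rewrite inE; apply/asboolP; exists 0; rewrite scale0r.
rewrite !inE => /asboolP[b <-] /asboolP[c <-]; apply/asboolP.
by exists (a * b + c); rewrite scalerDl scalerA.
Qed.
HB.instance Definition _ :=
  GRing.isSubmodClosed.Build R M cyclic_pred cyclic_submod_closed.

Lemma exists_cyclic_submod : exists (Z : lmodType R) (i : {linear Z -> M}),
  injective i /\ forall x, (exists z, i z = x) <-> exists b, b *: n = x.
Proof.
exists (submod cyclic_pred), val; split=> [|x]; first exact: val_inj.
split=> [[z <-]|xn]; first by have := valP z; rewrite inE => /asboolP.
by apply: submod_valP; rewrite inE; exact/asboolP.
Qed.

End Cyclic.

Lemma fd_mod_regular (K : fieldType) (A : falgType K) : fd_mod ((A^c)^o : lmodType A^c).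
Proof.
have [|g gE] := @exists_linear _ (A^c)^o {ffun 'I_1 -> (A^c)^o} (fun a => [ffun=> a]).
  by move=> a x y; apply/ffunP => i; rewrite !ffunE.
apply: (fd_mod_inj (f := g)); last exact: fd_mod_ffun.
by move=> x y; rewrite !gE => /ffunP/(_ ord0); rewrite !ffunE.
Qed.

Section CartanMatrix.
Variables (K : fieldType) (A : falgType K) (n : nat).
Variables (P : 'I_n -> lmodType A^c) (C : 'M[int]_n).
Hypotheses (hP : complete_indec_projectives P) (hC : cartan_matrix P C).
Variables (p : forall i, P i) (f : forall i, {linear P i -> (A^c)^o}).
Hypothesis pf : forall i, is_coord (p i) (f i).
Implicit Types M N X Y Z : lmodType A^c.

Let e i : A^c := f i (p i).
Let ee i : e i * e i = e i. Proof. exact: coord_idem (@pf i). Qed.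

Lemma fd_mod_indec_projective j : fd_mod (P j).
Proof.
apply: (fd_mod_inj (f := f j)) (fd_mod_regular A) => x y xy.
by rewrite -(@pf j x) xy pf.
Qed.

(** By duality, row [i] of [C] is the dimension vector of [D(A e_i)]; expanding it
    in the columns of [C] gives column [i] of [N]. *)
Lemma cartan_trmx_of_lattice :
    (forall i, in_cartan_lattice C p f (dual_summand (e i))) ->
  exists N : 'M[int]_n, C^T = C *m N.
Proof.
move=> /(_ _)/cid-/all_sig[c cE].
exists (\matrix_(k, i) c i k); apply/matrixP => j i; rewrite !mxE.
rewrite -(fix_dim_cartan hC pf).
rewrite -(fix_dim_dual_summand (@pf j) (ee i) (fd_mod_indec_projective j)) cE.
by apply: eq_bigr => k _; rewrite mxE.
Qed.

Lemma coord_neq0 j : p j <> 0.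
Proof.
move=> p0; have [/(_ j)[_ [nzP _]] _ _] := hP; apply: nzP => y.
by rewrite -[LHS](@pf j) p0 scaler0.
Qed.

Lemma fixed_neq0 M i : fd_mod M -> fix_dim (e i) M <> 0%N ->
  exists m : M, e i *: m = m /\ m <> 0.
Proof.
move=> fdM dM; apply: contrapT => noM; apply: dM.
apply/dimK_eq0; first exact: fin_dim_fixed.
move=> z; apply: fixed_incl_inj; rewrite linear0; apply: contrapT => nz.
by apply: noM; exists (fixed_incl z); split=> //; exact: fixed_inclK.
Qed.

Lemma fix_dim_neq0 M i (m : M) : fd_mod M -> e i *: m = m -> m <> 0 ->
  fix_dim (e i) M <> 0%N.
Proof.
move=> fdM em nzm /(dimK_eq0 (fin_dim_fixed (e i) fdM)).1 z0; apply: nzm.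
by have [z <-] := (fixed_inclP (e i) m).1 em; rewrite (z0 z) linear0.
Qed.

(** In a module in which any two nonzero elements generate the same submodule,
    nonzero elements [n] of [N e_i] and [m] of [N e_j] yield maps between [P_i] and
    [P_j] whose composites are not nilpotent; by Fitting's lemma these are
    isomorphisms. *)
Lemma indec_projective_eq N i j (x y : N) :
    e i *: x = x -> x <> 0 -> e j *: y = y -> y <> 0 ->
    (exists b : A^c, b *: x = y) -> (exists b : A^c, b *: y = x) ->
  i = j.
Proof.
have [indP isoP _] := hP.
have main k l (u v : N) (b b' : A^c) : e k *: u = u -> u <> 0 -> e l *: v = v ->
    b *: u = v -> b' *: v = u ->
    forall (al : {linear P l -> P k}) (be : {linear P k -> P l}),
    (forall z, al z = ((f l z : A^c) * b) *: p k) ->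
    (forall z, be z = ((f k z : A^c) * b') *: p l) -> bijective (al \o be)%FUN.
  move=> eu nzu ev bu bv al be alE beE; have [d dk _] := hC k k.
  have [//|[m m0]] := fitting_hom_dim (al \o be)%FUN (indP k).2 dk.
  have hatE z : (f k (al (be z)) : A^c) *: u = (f k z : A^c) *: u.
    have -> : (f k (al (be z)) : A^c) = (f l (be z) : A^c) * b * e k.
      by rewrite alE linearZ_LR.
    have -> : (f l (be z) : A^c) = (f k z : A^c) * b' * e l.
      by rewrite beE linearZ_LR.
    by rewrite -!scalerA eu bu ev bv.
  case: nzu; rewrite -eu.
  have : (f k (iter m (al \o be)%FUN (p k)) : A^c) *: u = e k *: u.
    by elim: m {m0} => //= m <-; rewrite hatE.
  by rewrite m0 linear0 scale0r => <-.
move=> ex nzx ey nzy [b bx] [b' by_].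
have [|al alE] := @exists_linear _ (P j) (P i) (fun z => ((f j z : A^c) * b) *: p i).
  by move=> a u v; rewrite linearP mulrDl scalerDl -mulrA scalerA.
have [|be beE] := @exists_linear _ (P i) (P j) (fun z => ((f i z : A^c) * b') *: p j).
  by move=> a u v; rewrite linearP mulrDl scalerDl -mulrA scalerA.
have [g1 g1K alK] := main i j x y b b' ex nzx ey bx by_ al be alE beE.
have bij_ba := main j i y x b' b ey nzy ex by_ bx be al beE alE.
have inj_al : injective al by move=> u v uv; apply: (bij_inj bij_ba); rewrite /= uv.
apply/esym/isoP; exists al; exists (be \o g1)%FUN => u; last exact: alK.
by apply: inj_al; exact: alK.
Qed.

(** A submodule of minimal positive dimension of [D(A e_j)] is simple, with
    projective cover [P_j]. *)
Lemma exists_simple_top j : exists N, [/\ fd_mod N, fix_dim (e j) N <> 0%N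
  & forall i, i != j -> fix_dim (e i) N = 0%N].
Proof.
pose I := dual_summand (e j).
pose Q k := `[< exists (N : lmodType A^c) (i : {linear N -> I}),
  [/\ injective i, ~ zero_module N & dimK (resK N) = k] >].
have exQ : exists k, Q k.
  exists (dimK (resK I)); apply/asboolP; exists I, idfun; split=> // zI.
  have := fix_dim_neq0 (fd_mod_indec_projective j) (@pf j (p j)) (@coord_neq0 j).
  rewrite -(fix_dim_dual_summand (@pf j) (ee j) (fd_mod_indec_projective j)).
  apply; apply/dimK_eq0; first exact/fin_dim_fixed/fd_mod_dual_summand.
  by move=> z; apply: fixed_incl_inj; rewrite linear0; exact: zI.
have [k /asboolP[N [i [inj_i nzN dN]]] mink] := ex_minnP exQ.
have fdN : fd_mod N by exact: fd_mod_inj inj_i (fd_mod_dual_summand _).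
(* By minimality the submodule generated by [x] has the dimension of [N]. *)
have simpleN (x y : N) : x <> 0 -> exists b : A^c, b *: x = y.
  move=> nzx; have [Z [s [inj_s sP]]] := exists_cyclic_submod x.
  apply/sP; apply: (@dimK_inj_surj _ _ _ (resK_fun s)) => //.
  rewrite dN; apply: mink; apply/asboolP; exists Z, (i \o s)%FUN; split=> //.
    exact: inj_comp.
  move=> zZ; have [z zE] : exists z, s z = x by apply/sP; exists 1; rewrite scale1r.
  by apply: nzx; rewrite -zE (zZ z) linear0.
(* If the functional [phi] in [N] is nonzero at [a], then [phi (a e_j)] is nonzero
   too, and this is the value at [1] of the translate of [phi] by [a e_j]. *)
have [m [em nzm]] : exists m : N, e j *: m = m /\ m <> 0.
  have [x nzx] : exists x : N, x <> 0 by exact/existsNP.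
  pose phi : Kdual A := ker_incl _ (i x).
  have [a nza] : exists a, phi a <> 0.
    apply/existsNP => phi0; apply: nzx; apply: inj_i.
    apply: (@ker_incl_inj _ _ _ (codefect (e j))); rewrite !linear0.
    by apply/lfunP => a; rewrite [LHS]phi0 zero_lfunE.
  exists ((e j * (a : A^c)) *: x); split; first by rewrite scalerA mulrA ee.
  move=> m0; apply: nza.
  have : ker_incl (codefect (e j)) (i ((e j * (a : A^c)) *: x)) 1 = 0.
    by rewrite m0 !linear0 zero_lfunE.
  rewrite !linearZ_LR [X in X = _ -> _]Kdual_scaleE mulr1 => <-.
  exact: esym (dual_summandE _ _).
exists N; split=> // [|l]; first exact: fix_dim_neq0 em nzm.
apply: contra_neqP => /(fixed_neq0 fdN)[x [ex nzx]].
exact: indec_projective_eq ex nzx em nzm (simpleN _ _ nzx) (simpleN _ _ nzm).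
Qed.

(** A row vector that annihilates [C] annihilates all dimension vectors, among
    which there are positive multiples of all the unit vectors. *)
Lemma cartan_det_neq0 :
  (forall M, fd_mod M -> in_cartan_lattice C p f M) -> \det C != 0.
Proof.
move=> allC; apply/det0P => -[v v_neq0 vC]; case/negP: v_neq0; apply/eqP/rowP => j.
have [N [fdN dj di]] := exists_simple_top j; have [c cE] := allC N fdN.
have : \sum_i v 0 i * (fix_dim (e i) N)%:Z = 0.
  transitivity (\sum_k (v *m C) 0 k * c k).
    rewrite (eq_bigr (fun i => \sum_k v 0 i * C i k * c k)) => [|i _].
      rewrite exchange_big; apply: eq_bigr => k _.
      by rewrite mxE mulr_suml.
    by rewrite cE mulr_sumr; apply: eq_bigr => k _; rewrite mulrA.
  by rewrite vC big1 // => k _; rewrite mxE mul0r.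
rewrite (bigD1 j) //= big1 => [|i /di->]; last exact: mulr0.
rewrite addr0 mxE => /eqP; rewrite mulf_eq0 => /orP[/eqP //|/eqP[]].
by move/dj.
Qed.

End CartanMatrix.

(** * Directed systems of idempotents *)

Section Directed.
Variables (K : fieldType) (A : falgType K) (V : finType) (v_idem : V -> A).

Hypothesis v_idemK : forall v, v_idem v * v_idem v = v_idem v.
Hypothesis v_idem_sum : \sum_v v_idem v = 1.

Let e v : A^c := v_idem v.

Lemma exists_homogeneous_basis (M : lmodType A^c) : fd_mod M ->
  exists (I : finType) (t : I -> V) (b : I -> M),
  [/\ forall j, e (t j) *: b j = b j,
      forall m, exists c : I -> K, m = \sum_j kscal A (c j) *: b j
    & forall c v, \sum_(j | t j == v) kscal A (c j) *: b j = 0 ->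
        forall j, t j == v -> c j = 0].
Proof.
move=> fdM; pose F v := fixed (e v) M.
have /(_ _)/cid-/all_sig[be beP] v := fin_dim_basis (fin_dim_fixed (e v) fdM).
pose I : finType := {v & 'I_(dimK (F v))}.
pose b (j : I) : M := fixed_incl (be (tag j) (tagged j)).
have sumE v (c : 'I_(dimK (F v)) -> K) : (fixed_incl (\sum_k c k *: be v k) : M) =
    \sum_k kscal A (c k) *: (fixed_incl (be v k) : M).
  by rewrite linear_sum; apply: eq_bigr => k _; rewrite linearZ_LR resK_scaleE.
exists I, tag, b; split=> [j|m|c v].
- exact: fixed_inclK.
- have /(_ _)/cid-/all_sig[c cE] v : exists c : 'I_(dimK (F v)) -> K,
      e v *: m = \sum_k kscal A (c k) *: (fixed_incl (be v k) : M).
    have [|z zE] := (fixed_inclP (e v) (e v *: m)).1.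
      by rewrite scalerA; congr (_ *: _); exact: v_idemK.
    by have [c [cE _]] := beP v z; exists c; rewrite -sumE -cE.
  exists (fun j => c (tag j) (tagged j)).
  rewrite -[LHS]scale1r.
  have -> : 1 = \sum_v e v :> A^c by exact: esym v_idem_sum.
  rewrite scaler_suml (eq_bigr _ (fun v _ => cE v)) sig_big_dep /=.
  by apply: eq_big => // -[v k].
- have -> : \sum_(j | tag j == v) kscal A (c j) *: b j =
      \sum_(u | u == v) \sum_(k < dimK (F u))
        kscal A (c (existT _ u k)) *: (fixed_incl (be u k) : M).
    by rewrite sig_big_dep /=; apply: eq_big => [j|[u k] _] //; rewrite andbT.
  rewrite big_pred1_eq -sumE => sum0 [u k] /= /eqP uv.
  move: k; rewrite uv => k.
  have [c0 [_ c0_uniq]] := beP v 0.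
  have /esym/c0_uniq c_eq : \sum_(k < dimK (F v)) c (existT _ v k) *: be v k = 0.
    by apply: fixed_incl_inj; rewrite sum0 linear0.
  have /c0_uniq : 0 = \sum_(k < dimK (F v)) (0 : K) *: be v k.
    by rewrite big1 // => l _; rewrite scale0r.
  by rewrite c_eq => /(congr1 (@^~ k)).
Qed.

(** The cover [Y] is the direct sum of the right modules [e_(t j) A], cut out of the
    free module as the image of an idempotent. *)
Lemma exists_homogeneous_cover (M : lmodType A^c) (I : finType) (t : I -> V)
    (b : I -> M) :
    (forall j, e (t j) *: b j = b j) ->
    (forall m, exists c : I -> K, m = \sum_j kscal A (c j) *: b j) ->
  exists (Y : lmodType A^c) (i : {linear Y -> {ffun I -> (A^c)^o}})
    (q : {linear Y -> M}),
  [/\ projective Y, injective i, forall m, exists y, q y = m,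
      forall y, q y = \sum_j (i y j : A^c) *: b j
    & forall y j, (i y j : A^c) * e (t j) = i y j].
Proof.
move=> bfix bspan; pose F : lmodType A^c := {ffun I -> (A^c)^o}.
have ee v : e v * e v = e v by exact: v_idemK.
have [|g gE] := @exists_linear _ F F (fun y => [ffun j => (y j : A^c) * e (t j)]).
  move=> a x y; apply/ffunP => j; rewrite !ffunE mulrDl.
  by congr (_ + _); exact: esym (mulrA _ _ _).
pose d : {linear F -> F} := (idfun \- g)%R.
have dE y : d y = y - g y by [].
have gg y : g (g y) = g y.
  by rewrite !gE; apply/ffunP => j; rewrite !ffunE -mulrA ee.
have [|r rE] := @exists_linear_factor _ _ _ _ (ker_incl d) g (@ker_incl_inj _ _ _ d).
  by move=> y; apply/ker_inclP; rewrite dE gg subrr.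
have gfix z : g (ker_incl d z) = ker_incl d z.
  by apply/esym/eqP; rewrite -subr_eq0 -dE ker_inclK.
have [|q0 q0E] := @exists_linear _ F M (fun y => \sum_j (y j : A^c) *: b j).
  move=> a x y; rewrite scaler_sumr -big_split; apply: eq_bigr => j _.
  by rewrite !ffunE scalerDl scalerA.
exists (ker d), (ker_incl d), (q0 \o ker_incl d)%FUN; split=> [||m|y|y j] /=.
- apply: (projective_retract (s := ker_incl d) (r := r)); last exact: projective_ffun.
  by move=> z; apply: (@ker_incl_inj _ _ _ d); rewrite rE gfix.
- exact: ker_incl_inj.
- have [c ->] := bspan m; exists (r [ffun j => kscal A (c j) : (A^c)^o]).
  rewrite rE q0E gE; apply: eq_bigr => j _; rewrite !ffunE -scalerA.
  by rewrite bfix.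
- exact: q0E.
- by rewrite -{2}(gfix y) gE ffunE.
Qed.

End Directed.

Section DirectedLattice.
Variables (K : fieldType) (A : falgType K) (n : nat).
Variables (P : 'I_n -> lmodType A^c) (C : 'M[int]_n).
Hypotheses (hP : complete_indec_projectives P) (hC : cartan_matrix P C).
Variables (p : forall i, P i) (f : forall i, {linear P i -> (A^c)^o}).
Hypothesis pf : forall i, is_coord (p i) (f i).

Variables (V : finType) (v_idem : V -> A) (rk : V -> nat) (h : nat).
Hypothesis v_idemK : forall v, v_idem v * v_idem v = v_idem v.
Hypothesis v_idem_sum : \sum_v v_idem v = 1.
Hypothesis rk_le : forall v, (rk v <= h)%N.
Hypothesis directed : forall u v a, (rk v <= rk u)%N ->
  exists c : K, v_idem u * a * v_idem v = if u == v then c *: v_idem v else 0.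

Let e v : A^c := v_idem v.

(** Let [r] be the least rank of a vertex [v] with [M e_v] nonzero. The homogeneous
    cover of [M] has no component of smaller rank, and it is an isomorphism on the
    components of rank [r], because there [e_u A e_v] is zero or spanned by [e_v].
    So its kernel only involves ranks greater than [r], and the ranks are bounded. *)
Lemma directed_in_cartan_lattice M : fd_mod M -> in_cartan_lattice C p f M.
Proof.
suff main k (N : lmodType A^c) : fd_mod N ->
    (forall v, (rk v + k <= h)%N -> forall x : N, e v *: x = 0) ->
    in_cartan_lattice C p f N.
  move=> fdM; apply: (main h.+1) => // v.
  by rewrite addnS ltnNge leq_addl.
elim: k N => [|k IHk] N fdN suppN.
  apply: (projective_in_cartan_lattice hP hC pf) => // X Y g l g_surj.
  exists (\0)%R => x.
  have -> : x = 0; last by rewrite !linear0.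
  rewrite -[x]scale1r.
  have -> : 1 = \sum_v e v :> A^c by exact: esym v_idem_sum.
  by rewrite scaler_suml big1 // => v _; rewrite suppN // addn0.
have [I [t [b [bfix bspan bfree]]]] := exists_homogeneous_basis v_idemK v_idem_sum fdN.
have [Y [i [q [projY inj_i q_surj qE iE]]]] := exists_homogeneous_cover v_idemK bfix bspan.
have exq := ker_short_exact q_surj.
have fdY : fd_mod Y by exact: fd_mod_inj inj_i (fd_mod_ffun _ _).
apply/(in_cartan_lattice_short_exact pf exq fdY fdN).
  exact: (projective_in_cartan_lattice hP hC pf).
apply: IHk => [|v le_vk z].
  by apply: fd_mod_inj fdY; exact: ker_incl_inj.
have rk_t j : (rk v <= rk (t j))%N.
  rewrite -(leq_add2r k); apply: leq_trans le_vk _; rewrite leqNgt -addnS.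
  apply/negP => /suppN b0; have /eqP[] : (1 : K) != 0 by exact: oner_neq0.
  have := @bfree (fun l => (l == j)%:R) (t j) _ j (eqxx _); rewrite eqxx; apply.
  rewrite (bigD1 j) //= -bfix b0 scaler0 add0r big1 // => l /andP[_ /negPf->].
  by rewrite raddf0 scale0r.
pose y := e v *: ker_incl q z.
have /(_ _)/cid-/all_sig[c cE] j : exists c : K,
    i y j = if t j == v then c *: v_idem v else 0.
  have [c dc] := directed (i (ker_incl q z) j) (rk_t j); exists c.
  rewrite -dc /y linearZ_LR ffunE -[in LHS]iE.
  by rewrite -[LHS]/(((v_idem (t j)) * (i (ker_incl q z) j : A)) * v_idem v).
have y0 : y = 0.
  apply: inj_i; apply/ffunP => j; rewrite linear0 cE ffunE; case: eqVneq => // tj.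
  rewrite (bfree c v) ?tj ?eqxx ?scale0r //.
  have qy0 : q y = 0 by rewrite /y linearZ_LR ker_inclK scaler0.
  rewrite -[RHS]qy0 qE [LHS]big_mkcond /=.
  apply: eq_bigr => l _; rewrite cE; case: eqVneq => [tl|_]; last by rewrite scale0r.
  rewrite -[in LHS]bfix tl scalerA; congr (_ *: _).
  by rewrite -[LHS]/(v_idem v * (c l)%:A) -scalerAr mulr1.
by apply: (@ker_incl_inj _ _ _ q); rewrite linearZ_LR -/y y0 linear0.
Qed.

End DirectedLattice.

(** * Triangular algebras are directed *)

Section Quiver.
Variables (K : fieldType) (Q : quiver).
Implicit Types p r : qpath Q.

Definition path_rank (v : vertex Q) : nat :=
  #|[set u | `[< exists p, pstart p = u /\ pend p = v >]]|.

(** Following [p] loses no vertex that reaches its start and gains its end, which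
    does not reach the start for lack of oriented cycles. *)
Lemma path_rank_lt p : acyclic Q -> (0 < plength p)%N ->
  (path_rank (pstart p) < path_rank (pend p))%N.
Proof.
move=> acQ p_gt0; apply: proper_card; apply/properP; split.
  apply/subsetP => u; rewrite !inE => /asboolP[r [<- rp]]; apply/asboolP.
  have [s rs _] := val_pcomp rp; exists s.
  by rewrite (pstart_pcomp rs) (pend_pcomp rs).
exists (pend p); rewrite !inE; first by apply/asboolP; exists (ptrivial (pend p)).
apply/asboolP => -[r [rs rp]]; have [s ps vs] := val_pcomp rp.
have /acQ : (0 < plength s)%N.
  by rewrite /plength /parrows vs /= size_cat addn_gt0 orbC p_gt0.
by rewrite (pstart_pcomp ps) (pend_pcomp ps) rs eqxx.
Qed.

Lemma plength0 p : plength p = 0%N -> p = ptrivial (pstart p).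
Proof.
move=> /size0nil p0; apply: val_inj => /=.
by rewrite [LHS]surjective_pairing; congr pair; exact: p0.
Qed.

Lemma ptrivial_mul u (p : qpath Q) :
  pbasis K (ptrivial u) * pbasis K p = if u == pstart p then pbasis K p else 0.
Proof.
rewrite [LHS]pamul_basis; case: eqVneq => [->|ne_up]; last by rewrite pcompN.
have [r -> vr] := @val_pcomp _ (ptrivial (pstart p)) p erefl.
congr (pbasis _ _); apply: val_inj; rewrite vr.
exact/esym/surjective_pairing.
Qed.

Lemma mul_ptrivial (p : qpath Q) v :
  pbasis K p * pbasis K (ptrivial v) = if pend p == v then pbasis K p else 0.
Proof.
rewrite [LHS]pamul_basis; case: eqVneq => [<-|ne_pv]; last by rewrite pcompN.
have [r -> vr] := @val_pcomp _ p (ptrivial (pend p)) erefl.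
congr (pbasis _ _); apply: val_inj; rewrite vr /pstart /parrows /= cats0.
exact/esym/surjective_pairing.
Qed.

Lemma ptrivial_sandwich u v p : acyclic Q -> (path_rank v <= path_rank u)%N ->
  exists c : K, pbasis K (ptrivial u) * pbasis K p * pbasis K (ptrivial v) =
    if u == v then c *: pbasis K (ptrivial v) else 0.
Proof.
move=> acQ le_vu; rewrite ptrivial_mul.
have zero : exists c : K, 0 = if u == v then c *: pbasis K (ptrivial v) else 0.
  by exists 0; rewrite scale0r if_same.
case: eqVneq => [uE|_]; last by rewrite mul0r.
rewrite mul_ptrivial; case: eqVneq => [vE|_] //.
have p0 : plength p = 0%N.
  apply/eqP; rewrite -leqn0 leqNgt; apply/negP => /(path_rank_lt acQ).
  by rewrite ltnNge -uE vE le_vu.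
exists 1; rewrite scale1r; rewrite -vE uE (plength0 p0) /pend /= eqxx.
by [].
Qed.

Lemma path_algebra_sandwich u v (x : path_algebra K Q) :
    acyclic Q -> (path_rank v <= path_rank u)%N ->
  exists c : K, pbasis K (ptrivial u) * x * pbasis K (ptrivial v) =
    if u == v then c *: pbasis K (ptrivial v) else 0.
Proof.
move=> acQ le_vu.
have /(_ _)/cid-/all_sig[c cE] p := ptrivial_sandwich p acQ le_vu.
exists (\sum_(p <- msupp x) x@_p * c p).
rewrite -[x in LHS]plift_id /plift mulr_sumr mulr_suml.
transitivity (\sum_(p <- msupp x) x@_p *:
    (if u == v then c p *: pbasis K (ptrivial v) else 0)).
  apply: eq_bigr => p _; rewrite -cE.
  rewrite -[LHS]/(pamul (pamul _ (x@_p *: pbasis K p)) _).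
  by rewrite linearZ /= [LHS]/pamul linearZ.
case: (u == v); last by apply: big1 => p _; exact: scaler0.
rewrite scaler_suml; apply: eq_bigr => p _.
exact: scalerA.
Qed.

End Quiver.

Lemma triangular_directed (K : fieldType) (A : falgType K) : triangular A ->
  exists (V : finType) (v_idem : V -> A) (rk : V -> nat) (h : nat),
  [/\ forall v, v_idem v * v_idem v = v_idem v, \sum_v v_idem v = 1,
      forall v, (rk v <= h)%N
    & forall u v a, (rk v <= rk u)%N -> exists c : K,
        v_idem u * a * v_idem v = if u == v then c *: v_idem v else 0].
Proof.
move=> [Q [S [pi [acQ _ [pi1 piM] pi_surj _]]]].
exists (vertex Q), (fun v => pi (pbasis K (ptrivial v))), (@path_rank Q), #|vertex Q|.
split=> [v||v|u v a le_vu].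
- by rewrite -piM ptrivial_mul eqxx.
- by rewrite -linear_sum -pi1.
- exact: max_card.
- have [x <-] := pi_surj a; have [c cE] := path_algebra_sandwich x acQ le_vu.
  exists c; rewrite -!piM cE; case: ifP => _; last exact: linear0.
  exact: linearZ_LR.
Qed.

(** * The Coxeter polynomial *)

Theorem corollary4p20 (K : fieldType) (A : falgType K)
    (n : nat) (P : 'I_n -> lmodType A^c) (C : 'M[int]_n)
    (hP : complete_indec_projectives P) (hC : cartan_matrix P C) :
  [/\ \det C != 0 ->
      (forall i j, coxeter_matrix C i j \is a Num.int) ->
      representable_by_monic (coxeter_poly C),
      iwanaga_gorenstein A -> \det C != 0 ->
      representable_by_monic (coxeter_poly C),
      triangular A ->
      \det C != 0 /\ representable_by_monic (coxeter_poly C)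
    & finite_gldim A ->
      \det C != 0 /\ representable_by_monic (coxeter_poly C)].
Proof.
have ex_coord i : exists pf : {p : P i & {linear P i -> (A^c)^o}},
    is_coord (projT1 pf) (projT2 pf).
  have [/(_ i)[projPi indPi] _ _] := hP; have [d dP _] := hC i i.
  by have [p [f pf]] := exists_coord projPi indPi dP; exists (existT _ p f).
have /(_ _)/cid-/all_sig[pf pfP] := ex_coord.
pose p i := projT1 (pf i); pose f i := projT2 (pf i).
have pfE i : is_coord (p i) (f i) by exact: pfP.
have ee i : (f i (p i) : A^c) * (f i (p i) : A^c) = f i (p i) by exact: coord_idem (@pfE i).
have of_lattice :
    (forall M, fd_mod M -> in_cartan_lattice C p f M) ->
    \det C != 0 /\ representable_by_monic (coxeter_poly C).
  move=> allC; have detC := cartan_det_neq0 hP hC pfE allC; split=> //.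
  have [|N CN] := cartan_trmx_of_lattice hC pfE.
    by move=> i; apply: allC; exact: fd_mod_dual_summand.
  exact: coxeter_representable_of_mul detC CN.
split.
- exact: coxeter_representable_of_int.
- move=> [[l resl] _] detC.
  have [|N CN] := cartan_trmx_of_lattice hC pfE.
    move=> i; apply: (all_pd_in_cartan_lattice hP hC pfE (l := l)).
      exact: fd_mod_dual_summand.
    apply: (all_pd_dual_summand (ee i)).
    exact/pd_le_all/has_proj_resolution_pd_le.
  exact: coxeter_representable_of_mul detC CN.
- move=> /triangular_directed[V [e [rk [h [eK e_sum rk_le dirA]]]]].
  by apply: of_lattice => M; exact: directed_in_cartan_lattice eK e_sum rk_le dirA M.
- move=> [l resl]; apply: of_lattice => M fdM.
  apply: (all_pd_in_cartan_lattice hP hC pfE (l := l)) => //.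
  exact/pd_le_all/has_proj_resolution_pd_le.
Qed.
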